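(* Let $C$ be a reducible real algebraic hypersurface of degree $N$ in $\mathbb{C}^n$, and let $\Gamma$ be a degree $k$ hypersurface that is a union of components of $C$, such that for each $i=1,\dots,n$ the $x_i$-axis intersects $\Gamma$ in the $k$ points $1/\alpha_{i1},\dots,1/\alpha_{ik}$, counted with multiplicities. Let $a_i=\alpha_{i1}\cdots\alpha_{ik}$, and suppose also that each point $1/\alpha_{1j}$ on the $x_1$-axis belongs only to components of $C$ contained in $\Gamma$. Let a tuple $(A_1,\dots,A_n)$ consisting of self-adjoint operators on $\mathbb{C}^N$, with $A_1$ invertible, be a determinantal representation of $C$, and suppose that $a_1$ is an eigenvalue of multiplicity $1$ for $\wedge^kA_1$. Then this representation induces a determinantal representation of $\Gamma$ if and only if the hypersurface $$\{\det(x_1\wedge^kA_1+\dots+x_n\wedge^kA_n-I)=0\}$$ contains the hyperplane $\{a_1x_1+\dots+a_nx_n=1\}$, and the hypersurface $$\{\det(x_1\wedge^{N-k}A_1+x_2\wedge^kA_2+\dots+x_n\wedge^kA_n-I)=0\}$$ contains the hyperplane $\{(\det A_1/a_1)x_1+a_2x_2+\dots+a_nx_n=1\}$.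
   Context: A real hypersurface is one defined by a polynomial with real coefficients. For a hypersurface defined by a polynomial $G=G_1^{r_1}\cdots G_m^{r_m}$ ($G_i$ irreducible, pairwise non-associate), its components are the hypersurfaces defined by the $G_i^{r_i}$ (irreducible but not necessarily reduced), and its degree is $\deg G$. A tuple $(A_1,\dots,A_n)$ of operators on a finite-dimensional space is here a determinantal representation of a hypersurface in $\mathbb{C}^n$ if that hypersurface (with multiplicities) is $\{\det(x_1A_1+\dots+x_nA_n-I)=0\}$. The representation $(A_1,\dots,A_n)$ of $C$ induces a determinantal representation of $\Gamma$ if there is a $k$-dimensional subspace $L\subset\mathbb{C}^N$ invariant under all $A_i$ such that $(A_1|_L,\dots,A_n|_L)$ is a determinantal representation of $\Gamma$. The point $1/\alpha_{ij}$ on the $x_i$-axis is the point whose $i$-th coordinate is $1/\alpha_{ij}$ and whose other coordinates are $0$. $\wedge^kA$ denotes the operator on $\bigwedge^k\mathbb{C}^N$ with $(\wedge^kA)(v_1\wedge\dots\wedge v_k)=Av_1\wedge\dots\wedge Av_k$. The operator $\wedge^{N-k}A$ is regarded as an operator on $\bigwedge^k\mathbb{C}^N$ through the canonical isomorphism $\bigwedge^kH^*\to\bigwedge^{N-k}H\otimes\bigwedge^NH^*$ together with the isomorphism $\bigwedge^kH\to\bigwedge^kH^*$ induced by the inner product ($H=\mathbb{C}^N$); for $A$ self-adjoint, this convention satisfies $(\wedge^{N-k}A)(\wedge^kA)=(\det A)I$, so for $A$ self-adjoint and invertible $\wedge^{N-k}A=\det(A)\,\wedge^k(A^{-1})$ on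 $\bigwedge^k\mathbb{C}^N$. *)

(* Defs.v *)
From HB Require Import structures.
From mathcomp Require Import all_boot all_order all_fingroup all_algebra.
From mathcomp Require Import sesquilinear mpoly.

Set Implicit Arguments.
Unset Strict Implicit.
Unset Printing Implicit Defensive.

Import Order.TTheory GRing.Theory Num.Theory.
Local Open Scope ring_scope.

Definition irreducible_elt (D : idomainType) (g : D) : Prop :=
  [/\ g != 0, g \isn't a GRing.unit &
      forall a b : D, g = a * b -> a \is a GRing.unit \/ b \is a GRing.unit].

Definition associated (D : idomainType) (p q : D) : Prop :=
  exists2 u : D, u \is a GRing.unit & p = u * q.

Section Hypersurfaces.

Variables (F : fieldType) (n : nat).
Implicit Types (P Q : {mpoly F[n]}) (x : 'I_n -> F) (i : 'I_n).

(* A hypersurface with multiplicities is a polynomial up to a unit, that is, up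
   to a nonzero scalar. *)
Definition same_hypersurface P Q : Prop := associated P Q.

(* The components of the hypersurface of P are those of the G l ^+ r l. *)
Definition components P (m : nat) (G : 'I_m -> {mpoly F[n]}) (r : 'I_m -> nat) :
    Prop :=
  [/\ forall l, irreducible_elt (G l),
      forall l l', l != l' -> ~ associated (G l) (G l'),
      forall l, (0 < r l)%N
    & same_hypersurface P (\prod_(l < m) G l ^+ r l)].

Definition on_hypersurface P x : Prop := P.@[x] = 0.

Definition hypersurface_sub P Q : Prop :=
  forall x, on_hypersurface P x -> on_hypersurface Q x.

Definition hyperplane (a : 'I_n -> F) : {mpoly F[n]} :=
  \sum_(i < n) a i *: 'X_i - 1.

Definition axis_point i (t : F) : 'I_n -> F := fun j => if j == i then t else 0.

(* The univariate polynomial P(0, ..., 0, 'X, 0, ..., 0), with 'X at index i. *)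
Definition on_axis i P : {poly F} :=
  mmap polyC (fun j => if j == i then 'X else 0) P.

Definition det_poly (d : nat) (A : 'I_n -> 'M[F]_d) : {mpoly F[n]} :=
  \det (\sum_(i < n) 'X_i *: map_mx (@mpolyC n F) (A i) - 1%:M).

Definition determinantal_representation P (d : nat) (A : 'I_n -> 'M[F]_d) :
    Prop :=
  same_hypersurface P (det_poly A).

(* Matrices act on row vectors, v |-> v *m A; the subspace is the row space of
   L, and conjmx (row_base L) A is the matrix of the restriction of A to it. *)
Definition induces_representation (N : nat) (A : 'I_n -> 'M[F]_N) P (k : nat) :
    Prop :=
  exists L : 'M[F]_N,
    [/\ \rank L = k, forall i, stablemx L (A i)
      & determinantal_representation P (fun i => conjmx (row_base L) (A i))].

End Hypersurfaces.

Section ExteriorPowers.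

Variables (C : numClosedFieldType) (N : nat).

(* The basis vectors e_s = e_(s_1) /\ ... /\ e_(s_k) of the k-th exterior power
   of C^N are indexed by the increasing k-tuples s. *)
Definition ext_index (k : nat) : {set k.-tuple 'I_N} :=
  [set s : k.-tuple 'I_N | sorted ltn (map val s)].

Definition ext_dim (k : nat) : nat := #|ext_index k|.

Definition basis_tuple k (p : 'I_(ext_dim k)) : k.-tuple 'I_N := enum_val p.

(* v_1 /\ ... /\ v_k in the basis e_s, where v_1, ..., v_k are the rows of V. *)
Definition wedge k (V : 'M[C]_(k, N)) : 'rV[C]_(ext_dim k) :=
  \row_p \det (colsub (tnth (basis_tuple p)) V).

(* The row of index s is A e_(s_1) /\ ... /\ A e_(s_k). *)
Definition extpow k (A : 'M[C]_N) : 'M[C]_(ext_dim k) :=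
  \matrix_(p, q) wedge (rowsub (tnth (basis_tuple p)) A) 0 q.

(* The coefficient of e_(w_1) /\ ... /\ e_(w_N) on e_1 /\ ... /\ e_N. *)
Definition top_coef (w : seq 'I_N) : C :=
  \det (\matrix_(i < N, j < N) (nth N (map val w) i == j)%:R).

(* The matrix of the exterior product of the k-th by the (N - k)-th power. *)
Definition wedge_pairing k : 'M[C]_(ext_dim k, ext_dim (N - k)) :=
  \matrix_(p, q) top_coef (basis_tuple p ++ basis_tuple q).

(* The isomorphism v |-> <., v> from the k-th power to its dual, which is
   conjugate-linear, followed by the canonical isomorphism from the dual to the
   (N - k)-th power, where e_1 /\ ... /\ e_N trivializes the top power. *)
Definition star k (v : 'rV[C]_(ext_dim k)) : 'rV[C]_(ext_dim (N - k)) :=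
  map_mx Num.conj v *m wedge_pairing k.

(* The operator extpow (N - k) A transported to the k-th power by star; it is
   linear since star is used once in each direction, whence the conjugate. *)
Definition dual_extpow k (A : 'M[C]_N) : 'M[C]_(ext_dim k) :=
  map_mx Num.conj (conjmx (wedge_pairing k) (extpow (N - k) A)).

End ExteriorPowers.

Section ExteriorPowersTheory.

Variables (C : numClosedFieldType) (N : nat).

Lemma basis_tuple_sorted k (p : 'I_(ext_dim N k)) : sorted ltn (map val (basis_tuple p)).
Proof. by have := enum_valP p; rewrite inE. Qed.

Lemma basis_tuple_uniq k (p : 'I_(ext_dim N k)) : uniq (basis_tuple p).
Proof.
rewrite -(map_inj_uniq val_inj).
exact: (sorted_uniq ltn_trans ltnn) (basis_tuple_sorted p).
Qed.

Lemma basis_tuple_eq k (p q : 'I_(ext_dim N k)) :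
  basis_tuple p =i basis_tuple q -> p = q.
Proof.
move=> E; apply: enum_val_inj; apply: val_inj => /=; apply: (inj_map val_inj).
apply: (irr_sorted_eq ltn_trans ltnn); try exact: basis_tuple_sorted.
by move=> x; apply/mapP/mapP => -[y yi ->]; exists y => //; rewrite ?E // -E.
Qed.

Lemma basis_tuple_ex k (w : seq 'I_N) : uniq w -> size w = k ->
  exists p : 'I_(ext_dim N k), perm_eq w (basis_tuple p).
Proof.
move=> uw sw.
have sw' : size (sort (fun i j : 'I_N => (i <= j)%N) w) == k by rewrite size_sort sw.
have : Tuple sw' \in ext_index N k.
  rewrite inE /= ltn_sorted_uniq_leq (map_inj_uniq val_inj) sort_uniq uw /=.
  rewrite sorted_map; apply: sort_sorted => i j; exact: leq_total.
move=> Ht; exists (enum_rank_in Ht (Tuple sw')).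
by rewrite /basis_tuple enum_rankK_in //= perm_sym perm_sort.
Qed.

Lemma alt_expand k (g : ('I_k -> 'I_N) -> C) (V : 'M[C]_(k, N)) :
  (forall f f', f =1 f' -> g f = g f') ->
  (forall f, ~ injective f -> g f = 0) ->
  (forall f (s : 'S_k), g (f \o s) = (-1) ^+ s * g f) ->
  \sum_(f : {ffun 'I_k -> 'I_N}) (\prod_a V a (f a)) * g f =
  \sum_p wedge V 0 p * g (tnth (basis_tuple p)).
Proof.
move=> gext gninj galt.
rewrite (bigID (fun f : {ffun _} => injectiveb f)) /= [X in _ + X]big1 ?addr0; last first.
  by move=> f /injectiveP fi; rewrite gninj ?mulr0.
have [p0|] := pickP 'I_(ext_dim N k); last first.
  move=> p0; rewrite big1 ?big1 // => [p|f /injectiveP fi]; first by have := p0 p.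
  have [||p _] := @basis_tuple_ex k (codom f); last by have := p0 p.
    by apply/injectiveP.
  by rewrite size_codom card_ord.
move=> _.
pose key (f : {ffun 'I_k -> 'I_N}) := odflt p0 [pick p | perm_eq (codom f) (basis_tuple p)].
have keyP (f : {ffun _ -> _}) : injectiveb f -> perm_eq (codom f) (basis_tuple (key f)).
  move=> fi; rewrite /key; case: pickP => //= H.
  have [||p Hp] := @basis_tuple_ex k (codom f) => //; last by rewrite H in Hp.
  by rewrite size_codom card_ord.
rewrite (partition_big key predT) //=; apply: eq_bigr => p _.
have bi : injective (tnth (basis_tuple p)) by apply/tuple_uniqP; apply: basis_tuple_uniq.
pose h (s : 'S_k) : {ffun 'I_k -> 'I_N} := [ffun a => tnth (basis_tuple p) (s a)].
have hi s : injectiveb (h s).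
  by apply/injectiveP => a b; rewrite !ffunE => /bi /perm_inj.
have hm s x : (x \in codom (h s)) = (x \in basis_tuple p).
  apply/codomP/tnthP => -[a ->]; first by exists (s a); rewrite ffunE.
  by exists ((s^-1)%g a); rewrite ffunE permKV.
rewrite (reindex h) /=; last first.
  pose ginv (f : {ffun 'I_k -> 'I_N}) : 'S_k := 
    odflt 1%g [pick s | h s == f].
  exists ginv => [s _|f /andP[fi /eqP fk]]; rewrite /ginv.
    case: pickP => [s' /eqP/ffunP E|/(_ s)]; last by rewrite eqxx.
    by apply/permP => a /=; have := E a; rewrite !ffunE => /bi.
  case: pickP => [s' /eqP //|] H.
  have Hx a : exists b, f a == tnth (basis_tuple p) b.
    have : f a \in basis_tuple p by rewrite -fk -(perm_mem (keyP _ fi)) codom_f.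
    by move=> /tnthP[b ->]; exists b.
  pose s0 a := xchoose (Hx a).
  have s0P a : f a = tnth (basis_tuple p) (s0 a) by apply/eqP; exact: (xchooseP (Hx a)).
  have s0i : injective s0.
    move=> a b E; apply: (injectiveP _ fi); by rewrite !s0P E.
  have := H (perm s0i); suff -> : h (perm s0i) = f by rewrite eqxx.
  by apply/ffunP => a; rewrite ffunE permE s0P.
rewrite (eq_bigl predT); last first.
  move=> s /=; rewrite hi /=; apply/eqP; apply: basis_tuple_eq => x.
  by rewrite -(perm_mem (keyP _ (hi s))) hm.
rewrite mxE mulr_suml; apply: eq_bigr => s _.
have -> : g (h s) = g (tnth (basis_tuple p) \o s) by apply: gext => a; rewrite ffunE.
rewrite galt mulrCA mulrA; congr (_ * _ * _).
by apply: eq_bigr => a _; rewrite mxE ffunE.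
Qed.

Lemma det_mulmx_expand k (V : 'M[C]_(k, N)) (B : 'M[C]_(N, k)) :
  \det (V *m B) = \sum_(f : {ffun 'I_k -> 'I_N}) (\prod_a V a (f a)) * \det (rowsub f B).
Proof.
rewrite /determinant; under [RHS]eq_bigr do rewrite mulr_sumr.
rewrite exchange_big /=; apply: eq_bigr => s _.
under eq_bigr => a _ do rewrite mxE.
rewrite bigA_distr_bigA mulr_sumr /=; apply: eq_bigr => f _.
rewrite mulrCA; congr (_ * _); rewrite -big_split; apply: eq_bigr => a _.
by rewrite !mxE.
Qed.

Lemma det_rowsub_ninj k (B : 'M[C]_(N, k)) f : ~ injective f -> \det (rowsub f B) = 0.
Proof.
move=> fi; have /injectivePn[a [b ab E]] : ~~ injectiveb f by apply/injectiveP.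
by apply: (determinant_alternate ab) => j; rewrite !mxE E.
Qed.

Lemma det_rowsub_perm k (B : 'M[C]_(N, k)) (f : 'I_k -> 'I_N) (s : 'S_k) :
   \det (rowsub (f \o s) B) = (-1) ^+ s * \det (rowsub f B).
Proof.
have -> : rowsub (f \o s) B = row_perm s (rowsub f B) by apply/matrixP => a b; rewrite !mxE.
by rewrite row_permE det_mulmx det_perm.
Qed.

Lemma cauchy_binet k (V : 'M[C]_(k, N)) (B : 'M[C]_(N, k)) :
  \det (V *m B) = \sum_p wedge V 0 p * \det (rowsub (tnth (basis_tuple p)) B).
Proof.
rewrite det_mulmx_expand (alt_expand (g := fun f => \det (rowsub f B))) //.
- by move=> f f' E; congr (\det _); apply/matrixP => a b; rewrite !mxE E.
- exact: det_rowsub_ninj.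
- exact: det_rowsub_perm.
Qed.

(* Together with wedge_basis, this characterizes extpow k A as the operator
   sending each v_1 /\ ... /\ v_k to A v_1 /\ ... /\ A v_k. *)
Lemma wedge_mulmx k (V : 'M[C]_(k, N)) (A : 'M[C]_N) :
  wedge (V *m A) = wedge V *m extpow k A.
Proof.
apply/rowP => q; rewrite !mxE.
have -> : colsub (tnth (basis_tuple q)) (V *m A) = V *m colsub (tnth (basis_tuple q)) A.
  by apply/matrixP => a b; rewrite !mxE; apply: eq_bigr => j _; rewrite !mxE.
rewrite cauchy_binet; apply: eq_bigr => p _; rewrite !mxE; congr (_ * \det _).
by apply/matrixP => a b; rewrite !mxE.
Qed.

Lemma wedge_basis k (p : 'I_(ext_dim N k)) :
  wedge (rowsub (tnth (basis_tuple p)) 1%:M : 'M[C]__) = delta_mx 0 p.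
Proof.
apply/rowP => q; rewrite !mxE eqxx /=; have [->|qp] := eqVneq q p.
  rewrite -[RHS](det1 C k); congr (\det _); apply/matrixP => a b; rewrite !mxE.
  by rewrite (inj_eq (elimT (tuple_uniqP _) (basis_tuple_uniq p))).
have [a Ha] : exists a, tnth (basis_tuple p) a \notin basis_tuple q.
  apply/existsP; apply: contraNT qp; rewrite negb_exists => /forallP H.
  have sub : {subset basis_tuple p <= basis_tuple q}.
    by move=> x /tnthP[a ->]; have := H a; rewrite negbK.
  apply/eqP/esym/basis_tuple_eq.
  by apply: (uniq_min_size (basis_tuple_uniq p) sub _).2; rewrite !size_tuple.
rewrite (expand_det_row _ a) big1 // => b _; rewrite !mxE.
case: eqP => [E|]; last by rewrite mul0r.
by rewrite E mem_tnth in Ha.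
Qed.

Lemma extpow_tr k (A : 'M[C]_N) : extpow k A^T = (extpow k A)^T.
Proof.
apply/matrixP => p q; rewrite !mxE -det_tr; congr (\det _).
by apply/matrixP => a b; rewrite !mxE.
Qed.

Lemma extpow_conj k (A : 'M[C]_N) :
  extpow k (map_mx Num.conj A) = map_mx Num.conj (extpow k A).
Proof.
apply/matrixP => p q; rewrite !mxE -det_map_mx; congr (\det _).
by apply/matrixP => a b; rewrite !mxE.
Qed.

Lemma top_coef_ninj (w : seq 'I_N) : size w = N -> ~~ uniq w -> top_coef C w = 0.
Proof.
move=> sw; case: w sw => [//|x0 w] sw /(uniqPn x0)[i [j [ij jn E]]].
have iN : (i < N)%N by rewrite -sw (ltn_trans ij).
have jN : (j < N)%N by rewrite -sw.
apply: (@determinant_alternate _ _ _ (Ordinal iN) (Ordinal jN)).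
  by rewrite -val_eqE /= ltn_eqF.
by move=> a; rewrite !mxE !(nth_map x0) ?sw // E.
Qed.

Lemma top_coef_perm (w : seq 'I_N) : size w = N -> uniq w ->
  exists s : 'S_N, top_coef C w = (-1) ^+ s.
Proof.
move=> sw uw.
have sw' : size w == N by apply/eqP.
have wi : injective (tnth (Tuple sw')) by apply/tuple_uniqP.
exists (perm wi); rewrite -det_perm /top_coef; congr (\det _).
apply/matrixP => i j; rewrite !mxE permE /= (nth_map i) ?sw //.
by rewrite (tnth_nth i).
Qed.

Lemma top_coef_conj (w : seq 'I_N) : Num.conj (top_coef C w) = top_coef C w.
Proof.
rewrite /top_coef -det_map_mx; congr (\det _).
by apply/matrixP => i j; rewrite !mxE rmorph_nat.
Qed.

Lemma pairing_disj k l (p : 'I_(ext_dim N k)) (q : 'I_(ext_dim N l)) :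
  (k + l)%N = N -> top_coef C (basis_tuple p ++ basis_tuple q) != 0 ->
  forall x, (x \in basis_tuple q) = (x \notin basis_tuple p).
Proof.
move=> E nz; have sw : size (basis_tuple p ++ basis_tuple q) = N.
  by rewrite size_cat !size_tuple.
have uw : uniq (basis_tuple p ++ basis_tuple q).
  by apply: contraNT nz => /(top_coef_ninj sw) ->.
have full x : x \in basis_tuple p ++ basis_tuple q.
  have sub : {subset basis_tuple p ++ basis_tuple q <= enum 'I_N}.
    by move=> y _; rewrite mem_enum.
  by rewrite ((uniq_min_size uw sub _).2 x) ?mem_enum // sw size_enum_ord.
move=> x; apply/idP/idP => [xq|xp].
  apply: contraL uw => xp; rewrite cat_uniq negb_and; apply/orP; right.
  by rewrite negb_and; apply/orP; left; rewrite negbK; apply/hasP; exists x.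
by have := full x; rewrite mem_cat (negPf xp).
Qed.

Lemma pairing_orth k l (p p' : 'I_(ext_dim N k)) : (k + l)%N = N ->
  \sum_(q < ext_dim N l) top_coef C (basis_tuple p ++ basis_tuple q) *
     top_coef C (basis_tuple p' ++ basis_tuple q) = (p == p')%:R.
Proof.
move=> E; have [<-|pp'] := eqVneq p p'; last first.
  rewrite big1 // => q _; apply: contra_neq_eq pp'.
  rewrite mulf_eq0 negb_or => /andP[/(pairing_disj E) h /(pairing_disj E) h'].
  by apply: basis_tuple_eq => x; apply: negb_inj; rewrite -h -h'.
have up := basis_tuple_uniq p.
pose w := [seq x <- enum 'I_N | x \notin basis_tuple p].
have [||q0 Hq0] := @basis_tuple_ex l w.
- by rewrite filter_uniq // enum_uniq.
- rewrite size_filter; have := count_predC (mem (basis_tuple p)) (enum 'I_N).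
  rewrite size_enum_ord => H; apply/eqP; rewrite -(eqn_add2l k); apply/eqP.
  apply: etrans (etrans H (esym E)); rewrite -[in RHS]size_filter; congr (_ + _)%N.
  rewrite -[LHS](size_tuple (basis_tuple p)); apply: perm_size; apply: uniq_perm => //.
    by rewrite filter_uniq // enum_uniq.
  by move=> x; rewrite mem_filter mem_enum andbT.
have Hq x : (x \in basis_tuple q0) = (x \notin basis_tuple p).
  by rewrite -(perm_mem Hq0) mem_filter mem_enum andbT.
rewrite (bigD1 q0) //= big1 ?addr0; last first.
  move=> q; apply: contra_neq_eq; rewrite mulf_eq0 orbb => /(pairing_disj E) h.
  by apply: basis_tuple_eq => x; rewrite h Hq.
have [||s ->] := @top_coef_perm (basis_tuple p ++ basis_tuple q0).
- by rewrite size_cat !size_tuple.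
- rewrite cat_uniq up basis_tuple_uniq andbT /=; apply/hasPn => x.
  by rewrite Hq.
by rewrite -signr_addb addbb.
Qed.


Lemma wedge_pairingK k : (k <= N)%N ->
  wedge_pairing C N k *m (wedge_pairing C N k)^T = 1%:M.
Proof.
move=> kN; apply/matrixP => p p'; rewrite !mxE -(pairing_orth p p' (subnKC kN)).
by apply: eq_bigr => q _; rewrite !mxE.
Qed.

Lemma pinv_pairing k : (k <= N)%N ->
  pinvmx (wedge_pairing C N k) = (wedge_pairing C N k)^T.
Proof.
move=> kN; set S := wedge_pairing C N k; have SK : S *m S^T = 1%:M := wedge_pairingK kN.
have fS : row_free S by apply/row_freeP; exists S^T.
have fuS : row_full S.
  rewrite /row_full (eqP fS) /ext_dim !card_ltn_sorted_tuples.
  by rewrite bin_sub.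
by rewrite -[LHS]mulmx1 -SK mulmxA mulVpmx // mul1mx.
Qed.

(* u /\ star v = <u, v> e_1 /\ ... /\ e_N, for the standard hermitian product. *)
Lemma star_pairing k (u v : 'rV[C]_(ext_dim N k)) : (k <= N)%N ->
  u *m wedge_pairing C N k *m (star v)^T = u *m (map_mx Num.conj v)^T.
Proof.
by move=> kN; rewrite trmx_mul !mulmxA -(mulmxA u) wedge_pairingK ?mulmx1.
Qed.

Lemma pairing_conj k : map_mx Num.conj (wedge_pairing C N k) = wedge_pairing C N k.
Proof. by apply/matrixP => p q; rewrite !mxE top_coef_conj. Qed.

Lemma map_conjK m n : involutive (map_mx Num.conj : 'M[C]_(m, n) -> 'M[C]_(m, n)).
Proof. by move=> M; apply/matrixP => p q; rewrite !mxE conjCK. Qed.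

Lemma star_dual_extpow k (A : 'M[C]_N) (v : 'rV[C]_(ext_dim N k)) : (k <= N)%N ->
  star (v *m dual_extpow k A) = star v *m extpow (N - k) A.
Proof.
move=> kN; rewrite /star /dual_extpow map_mxM /= map_conjK /conjmx.
rewrite pinv_pairing // -!mulmxA; congr (_ *m (_ *m _)).
have SK := wedge_pairingK kN; have P := pinv_pairing kN.
have fS : row_free (wedge_pairing C N k) by apply/row_freeP; exists (wedge_pairing C N k)^T.
rewrite -P mulVpmx ?mulmx1 // /row_full (eqP fS) /ext_dim !card_ltn_sorted_tuples.
by rewrite bin_sub.
Qed.

End ExteriorPowersTheory.

Section Laplace.

Variables (C : numClosedFieldType) (k l : nat).
Notation N := (k + l)%N.
Implicit Types (V : 'M[C]_(k, N)) (W : 'M[C]_(l, N)).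

Lemma top_coef_col_mx (p : 'I_(ext_dim N k)) (q : 'I_(ext_dim N l)) :
  top_coef C (basis_tuple p ++ basis_tuple q) =
  \det (col_mx (rowsub (tnth (basis_tuple p)) 1%:M) (rowsub (tnth (basis_tuple q)) 1%:M)).
Proof.
congr (\det _); apply/matrixP => i j; rewrite !mxE map_cat nth_cat size_map size_tuple.
case: splitP => a ia; rewrite !mxE ia.
  by rewrite (nth_map i) ?size_tuple // (tnth_nth i).
by rewrite addKn (nth_map i) ?size_tuple // (tnth_nth i).
Qed.

Lemma det_col_mx_expand V W : \det (col_mx V W) =
  \sum_(f : {ffun 'I_k -> 'I_N}) (\prod_a V a (f a)) * \det (col_mx (rowsub f 1%:M) W).
Proof.
rewrite /determinant; under [RHS]eq_bigr do rewrite mulr_sumr.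
rewrite exchange_big /=; apply: eq_bigr => s _.
rewrite [in LHS]big_split_ord /=.
have -> : \prod_(a < k) col_mx V W (lshift l a) (s (lshift l a)) =
    \prod_(a < k) \sum_j V a j * (j == s (lshift l a))%:R.
  apply: eq_bigr => a _; rewrite col_mxEu (bigD1 (s (lshift l a))) //= eqxx mulr1.
  by rewrite big1 ?addr0 // => j /negPf->; rewrite mulr0.
rewrite bigA_distr_bigA mulr_suml mulr_sumr; apply: eq_bigr => f _.
rewrite big_split_ord big_split /= mulrCA -!mulrA; congr (_ * _).
rewrite mulrCA; congr (_ * (_ * _)).
  by apply: eq_bigr => a _; rewrite col_mxEu !mxE.
by apply: eq_bigr => a _; rewrite !col_mxEd.
Qed.

Lemma laplaceV V W : \det (col_mx V W) =
  \sum_p wedge V 0 p * \det (col_mx (rowsub (tnth (basis_tuple p)) 1%:M) W).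
Proof.
rewrite det_col_mx_expand.
rewrite (alt_expand (g := fun f => \det (col_mx (rowsub f 1%:M) W))) //.
- move=> f f' E; congr (\det (col_mx _ _)).
  by apply/matrixP => a b; rewrite !mxE E.
- move=> f fi; have /injectivePn[a [b ab E]] : ~~ injectiveb f by apply/injectiveP.
  apply: (@determinant_alternate _ _ _ (lshift l a) (lshift l b)).
    by rewrite (inj_eq (@lshift_inj _ _)).
  by move=> j; rewrite !col_mxEu !mxE E.
- move=> f s.
  have -> : col_mx (rowsub (f \o s) 1%:M) W =
      block_mx (perm_mx s) 0 0 1%:M *m col_mx (rowsub f 1%:M) W.
    rewrite mul_block_col mul0mx addr0 mul0mx add0r mul1mx -row_permE.
    by congr col_mx; apply/matrixP => a b; rewrite !mxE.
  by rewrite det_mulmx det_ublock det_perm det1 mulr1.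
Qed.
Lemma det_col_mx_expandr V W : \det (col_mx V W) =
  \sum_(f : {ffun 'I_l -> 'I_N}) (\prod_a W a (f a)) * \det (col_mx V (rowsub f 1%:M)).
Proof.
rewrite /determinant; under [RHS]eq_bigr do rewrite mulr_sumr.
rewrite exchange_big /=; apply: eq_bigr => s _.
rewrite [in LHS]big_split_ord /=.
have -> : \prod_(a < l) col_mx V W (rshift k a) (s (rshift k a)) =
    \prod_(a < l) \sum_j W a j * (j == s (rshift k a))%:R.
  apply: eq_bigr => a _; rewrite col_mxEd (bigD1 (s (rshift k a))) //= eqxx mulr1.
  by rewrite big1 ?addr0 // => j /negPf->; rewrite mulr0.
rewrite bigA_distr_bigA 2!mulr_sumr; apply: eq_bigr => f _.
rewrite big_split_ord big_split /= [RHS]mulrCA; congr (_ * _).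
rewrite [RHS]mulrCA; congr (_ * (_ * _)).
  by apply: eq_bigr => a _; rewrite !col_mxEu.
by apply: eq_bigr => a _; rewrite col_mxEd !mxE.
Qed.

Lemma laplaceW V W : \det (col_mx V W) =
  \sum_p wedge W 0 p * \det (col_mx V (rowsub (tnth (basis_tuple p)) 1%:M)).
Proof.
rewrite det_col_mx_expandr.
rewrite (alt_expand (g := fun f => \det (col_mx V (rowsub f 1%:M)))) //.
- move=> f f' E; congr (\det (col_mx _ _)).
  by apply/matrixP => a b; rewrite !mxE E.
- move=> f fi; have /injectivePn[a [b ab E]] : ~~ injectiveb f by apply/injectiveP.
  apply: (@determinant_alternate _ _ _ (rshift k a) (rshift k b)).
    by rewrite (inj_eq (@rshift_inj _ _)).
  by move=> j; rewrite !col_mxEd !mxE E.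
- move=> f s.
  have -> : col_mx V (rowsub (f \o s) 1%:M) =
      block_mx 1%:M 0 0 (perm_mx s) *m col_mx V (rowsub f 1%:M).
    rewrite mul_block_col mul0mx addr0 mul0mx add0r mul1mx -row_permE.
    by congr col_mx; apply/matrixP => a b; rewrite !mxE.
  by rewrite det_mulmx det_ublock det_perm det1 mul1r.
Qed.

Lemma laplace (A : 'M[C]_N) (p : 'I_(ext_dim N k)) (q : 'I_(ext_dim N l)) :
  \sum_p' extpow k A p p' * (\sum_q' extpow l A q q' *
     top_coef C (basis_tuple p' ++ basis_tuple q')) =
  \det A * top_coef C (basis_tuple p ++ basis_tuple q).
Proof.
rewrite top_coef_col_mx mulrC -det_mulmx mul_col_mx !mul_rowsub_mx !mul1mx.
rewrite laplaceV; apply: eq_bigr => p' _; rewrite mxE; congr (_ * _).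
rewrite laplaceW; apply: eq_bigr => q' _; rewrite mxE; congr (_ * _).
by rewrite top_coef_col_mx.
Qed.

End Laplace.

Section DualExtpow.

Variables (C : numClosedFieldType) (N : nat).

Lemma laplace_mx k (A : 'M[C]_N) : (k <= N)%N ->
  extpow k A *m wedge_pairing C N k *m (extpow (N - k) A)^T =
  \det A *: wedge_pairing C N k.
Proof.
move=> kN; apply/matrixP => p q; rewrite [RHS]mxE [X in _ * X]mxE.
move: q; rewrite /wedge_pairing; have := subnKC kN; move: (N - k)%N => l E.
move: A p {kN}; case: N / E => A p q.
rewrite -laplace -mulmxA mxE; apply: eq_bigr => p' _; congr (_ * _).
by rewrite mxE; apply: eq_bigr => q' _; rewrite !mxE mulrC.
Qed.

Lemma dual_extpow_mul k (A : 'M[C]_N) : (k <= N)%N -> A \is hermsymmx ->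
  dual_extpow k A *m extpow k A = (\det A)%:M.
Proof.
move=> kN; rewrite is_hermitianmxE expr0 scale1r => /eqP hA.
have eA : map_mx Num.conj A = A^T by apply/matrixP => a b; rewrite [in RHS]hA !mxE.
rewrite /dual_extpow /conjmx pinv_pairing // !map_mxM /= -matrix.map_trmx.
rewrite pairing_conj -extpow_conj eA.
apply: trmx_inj; rewrite !trmx_mul trmxK -(extpow_tr k) !mulmxA laplace_mx // det_tr.
by rewrite -scalemxAl wedge_pairingK // tr_scalar_mx scalemx1.
Qed.

End DualExtpow.

(* Main.v *)
Require Import Defs.
From mathcomp Require Import all_boot all_order all_fingroup all_algebra.
From mathcomp Require Import sesquilinear complex mpoly reals ring zify.

(* If L is invariant and V is a basis of L, then the wedge of V is a common
   eigenvector of the exterior powers, with eigenvalues det(A_i|L) = a_i.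

   Conversely, let xi be the eigenvector of wedge^k A_1 for the simple
   eigenvalue a_1, that is, the wedge of the eigenvectors of A_1 for the
   alpha_1j. Diagonalize wedge^k A_1, let mu_q be its other eigenvalues and b_q
   the components of (wedge^k A_i) xi along their eigenvectors. The first
   hyperplane makes the pencil singular along a line; at order one this gives
   <(wedge^k A_i) xi, xi> = a_i, and at order two
   sum_q |b_q|^2 / (mu_q / a_1 - 1) = 0. The second hyperplane gives in the same
   way sum_q |b_q|^2 / (a_1 / mu_q - 1) = 0. Adding up, sum_q |b_q|^2 = 0, so xi
   is a common eigenvector, and its support L is invariant under all A_i.

   It remains to see that det(sum x_i A_i|L - 1), a factor of the polynomial of
   C, defines Gamma. It agrees with Gamma on the x_1-axis, where Gamma has no
   point in common with the rest of C; so the two factorizations agree by the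
   uniqueness part of Hensel's lemma, in powers of t after x_i := t x_i for
   i > 1. *)

Set Implicit Arguments.
Unset Strict Implicit.
Unset Printing Implicit Defensive.

Import Order.TTheory GRing.Theory Num.Theory.
Local Open Scope ring_scope.

(** * Uniqueness in Hensel's lemma *)

(** Induction on the degree in the outer variable t. At degree m + 1 the earlier terms cancel and
    leave e g_0 = f_0 h, where e = f_(m+1) - f'_(m+1) and h = g'_(m+1) - g_(m+1). The Bezout
    identity then makes f_0 divide e, and deg e < k = deg f_0 forces e = 0; cancelling f_0 gives h =
    0. *)
Lemma hensel_unique (D : idomainType) (k : nat) (f g f' g' : {poly {poly D}}) (u v : {poly D}) :
  size f`_0 = k.+1 -> u * f`_0 + v * g`_0 = 1 ->
  f`_0 = f'`_0 -> g`_0 = g'`_0 ->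
  (forall j, (0 < j)%N -> (size (f`_j)%R <= k)%N /\ (size (f'`_j)%R <= k)%N) ->
  f * g = f' * g' -> f = f'.
Proof.
move=> szf bez f00 g00 szj fg.
have f0 : f`_0 != 0 by rewrite -size_poly_eq0 szf.
suff H : forall m, f`_m = f'`_m /\ g`_m = g'`_m by apply/polyP => m; case: (H m).
move=> m; elim/ltn_ind: m => -[|m] IH //.
have := congr1 (fun p : {poly {poly D}} => p`_m.+1) fg.
rewrite !coefM !(big_ord_recl m.+1) !(big_ord_recr m) /= !subn0 !subnn.
set s := \sum_(i < m) _; set s' := \sum_(i < m) _.
have -> : s = s'.
  apply: eq_bigr => i _; rewrite /bump /= !add1n subSS.
  have lt1 : (i.+1 < m.+1)%N by rewrite ltnS ltn_ord.
  have lt2 : (m - i < m.+1)%N by rewrite ltnS leq_subr.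
  by rewrite (IH _ lt1).1 (IH _ lt2).2.
rewrite -f00 -g00 /bump leq0n add1n => /eqP; rewrite -subr_eq0 => /eqP E.
have E1 : (f`_m.+1 - f'`_m.+1) * g`_0 = f`_0 * (g'`_m.+1 - g`_m.+1).
  apply/eqP; rewrite -subr_eq0; apply/eqP; apply: etrans E; ring.
have E2 : f`_m.+1 - f'`_m.+1 =
    f`_0 * (u * (f`_m.+1 - f'`_m.+1) + v * (g'`_m.+1 - g`_m.+1)).
  rewrite -[LHS]mul1r -bez.
  transitivity (u * f`_0 * (f`_m.+1 - f'`_m.+1) + v * ((f`_m.+1 - f'`_m.+1) * g`_0)).
    by ring.
  by rewrite E1; ring.
have e0 : f`_m.+1 - f'`_m.+1 = 0.
  set w := (X in _ * X) in E2; have [w0|w0] := eqVneq w 0.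
    by rewrite E2 w0 mulr0.
  have [le1 le2] := szj m.+1 isT.
  have : (size (f`_m.+1 - f'`_m.+1)%R <= k)%N.
    by rewrite (leq_trans (size_polyD _ _)) // geq_max size_polyN le1 le2.
  rewrite E2 size_mul // szf addSn /= leqNgt -[X in (X < _)%N]addn0 ltn_add2l.
  by rewrite size_poly_gt0 w0.
split; first by apply/eqP; rewrite -subr_eq0 e0.
move: E1; rewrite e0 mul0r => /esym/eqP; rewrite mulf_eq0 (negPf f0) subr_eq0 /=.
by move/eqP.
Qed.

(** * Evaluation and degree of determinantal polynomials *)

Section Evaluation.

Variables (F : fieldType) (n : nat).

(** Point evaluation and restriction to an axis are both instances of [mmap], and ring morphisms
    commute with determinants, so one formula serves both. *)
Lemma mmap_det_poly (S : comNzRingType) (f : {rmorphism F -> S}) (h : 'I_n -> S) d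
    (A : 'I_n -> 'M[F]_d) :
  mmap f h (det_poly A) = \det (\sum_i h i *: map_mx f (A i) - 1%:M).
Proof.
rewrite /det_poly -det_map_mx; congr (\det _); apply/matrixP => i j.
rewrite !mxE rmorphB /= rmorph_nat !summxE rmorph_sum; congr (_ - _).
by apply: eq_bigr => l _; rewrite !mxE rmorphM /= mmapC mmapX mmap1U.
Qed.

Lemma meval_det_poly d (A : 'I_n -> 'M[F]_d) x :
  (det_poly A).@[x] = \det (\sum_i x i *: A i - 1%:M).
Proof.
rewrite /meval mmap_det_poly; congr (\det (_ - _)); apply: eq_bigr => i _.
by rewrite map_mx_id.
Qed.

Lemma on_axis_det_poly d (A : 'I_n -> 'M[F]_d) i :
  on_axis i (det_poly A) = \det ('X *: map_mx polyC (A i) - 1%:M).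
Proof.
rewrite /on_axis mmap_det_poly (bigD1 i) //= eqxx big1 ?addr0 // => j /negPf->.
by rewrite scale0r.
Qed.

Lemma horner_on_axis i (P : {mpoly F[n]}) t : (on_axis i P).[t] = P.@[axis_point i t].
Proof.
rewrite /on_axis /meval /mmap horner_sum; apply: eq_bigr => m _.
rewrite hornerM hornerC /mmap1 horner_prod; congr (_ * _); apply: eq_bigr => j _.
by rewrite horner_exp /axis_point; case: eqP; rewrite ?hornerX ?hornerC.
Qed.

Lemma meval_hyperplane (a : 'I_n -> F) x : (hyperplane a).@[x] = \sum_i a i * x i - 1.
Proof.
rewrite /hyperplane mevalB meval1 raddf_sum /=; congr (_ - _).
by apply: eq_bigr => i _; rewrite mevalZ mevalXU.
Qed.

End Evaluation.

(** Each term of the Leibniz expansion is a product of d entries of total degree at most 1. *)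
Lemma msize_det_poly (F : fieldType) n d (A : 'I_n -> 'M[F]_d) :
  (msize (det_poly A) <= d.+1)%N.
Proof.
have szX (c : F) (i : 'I_n) : (msize (c *: 'X_i) <= 2)%N.
  by rewrite (leq_trans (msizeZ_le _ _)) // msizeX mdeg1.
rewrite /det_poly /determinant; apply: (leq_trans (mmeasure_sum _ _ _ _)).
apply/bigmax_leqP_seq => s _ _.
rewrite mulr_sign; set q := \prod_(_ < _) _; suff : (msize q <= d.+1)%N.
  by case: ifP; rewrite ?mmeasureN.
rewrite {}/q.
have le2 (i j : 'I_d) :
    (msize ((\sum_i0 'X_i0 *: map_mx (@mpolyC n F) (A i0) - 1%:M) i j) <= 2)%N.
  rewrite !mxE summxE (leq_trans (mmeasureD_le _ _ _)) // geq_max mmeasureN.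
  rewrite -mpolyC_nat mmeasureC (leq_trans (leq_b1 _)) // andbT.
  apply: (leq_trans (mmeasure_sum _ _ _ _)); apply/bigmax_leqP_seq => l _ _.
  by rewrite !mxE mulrC mul_mpolyC.
(* Writing d as a sum of ones lets the product and its degree bound be built up together. *)
have -> : d.+1 = (\sum_(i < d) 1).+1 by rewrite sum1_card card_ord.
apply: (big_rec2 (fun p m => (msize p <= m.+1)%N)) => [|i p m _ IH]; first by rewrite msize1.
have [->|p0] := eqVneq p 0; first by rewrite mulr0 mmeasure0.
set e := (X in msize (X * _)); have [->|e0] := eqVneq e 0; first by rewrite mul0r mmeasure0.
rewrite msizeM //; have : (msize e <= 2)%N := le2 i (s i).
by move: (msize e) (msize p) IH => x y; lia.
Qed.

(** * Factorizations determined by their restriction to an axis *)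

(** A Bezout identity on the axis, over the field [F], is carried by [lift] to the coefficients of
    t^0. Cancelling [ax f] shows that g and g' agree on the axis as well. *)
Lemma hensel_lift (F : fieldType) (A : pzRingType) (D : idomainType)
    (phi : {rmorphism A -> {poly {poly D}}}) (ax : {rmorphism A -> {poly F}})
    (lift : {rmorphism F -> D}) (k : nat) (f g f' g' : A) :
  (forall p, (phi p)`_0 = map_poly lift (ax p)) ->
  (forall j, (0 < j)%N ->
     (size ((phi f)`_j)%R <= k)%N /\ (size ((phi f')`_j)%R <= k)%N) ->
  size (ax f) = k.+1 -> coprimep (ax f) (ax g) -> ax f = ax f' ->
  f * g = f' * g' -> phi f = phi f'.
Proof.
move=> phi0 szj sz0 /Bezout_eq1_coprimepP[[u v] /= uv] E fg.
have f0 : ax f != 0 by rewrite -size_poly_gt0 sz0.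
have fg0 : ax f * ax g = ax f * ax g' by rewrite [in RHS]E -!rmorphM fg.
apply: (@hensel_unique _ k _ (phi g) _ (phi g') (map_poly lift u) (map_poly lift v)) => //.
- by rewrite phi0 size_map_poly.
- by rewrite !phi0 -!rmorphM -rmorphD /= uv rmorph1.
- by rewrite !phi0 E.
- by rewrite !phi0 (mulfI f0 fg0).
- by rewrite -!rmorphM fg.
Qed.

Section Pencil.

Variables (F : fieldType) (n : nat) (D : idomainType).
Variables (lift : {rmorphism F -> D}) (y : 'I_n.+1 -> D).
Notation M := {mpoly F[n.+1]}.

Definition pencil_var (i : 'I_n.+1) : {poly {poly D}} :=
  if i == ord0 then 'X%:P else (y i)%:P *: 'X.

(* The substitution x_0 := X, x_i := t y_i; the outer variable is t. *)
Definition pencil : {rmorphism M -> {poly {poly D}}} :=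
  mmap (polyC \o polyC \o lift) pencil_var.

(** When the y_i are independent variables, this recovers p from its pencil, so equal pencils come
    from equal polynomials. *)
Lemma pencil1 p : (pencil p).[1].[y ord0] = mmap lift y p.
Proof.
rewrite /pencil /= /mmap !horner_sum; apply: eq_bigr => m _.
rewrite !hornerM !hornerC; congr (_ * _).
rewrite /mmap1 !horner_prod; apply: eq_bigr => i _; rewrite !horner_exp; congr (_ ^+ _).
rewrite /pencil_var; case: eqP => [->|_]; first by rewrite !(hornerC, hornerX).
by rewrite !(hornerZ, hornerX, hornerC) mulr1 hornerC.
Qed.

Lemma pencil_coef0 p : (pencil p)`_0 = map_poly lift (on_axis ord0 p).
Proof.
rewrite -horner_coef0 /pencil /on_axis /= /mmap horner_sum rmorph_sum.
apply: eq_bigr => m _; rewrite hornerM hornerC rmorphM /= map_polyC; congr (_ * _).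
rewrite /mmap1 horner_prod rmorph_prod; apply: eq_bigr => i _.
rewrite horner_exp rmorphXn /pencil_var; congr (_ ^+ _).
case: eqP => _; first by rewrite hornerC /= map_polyX.
by rewrite hornerZ hornerX mulr0 rmorph0.
Qed.

(** This bounds the total degree in X and t by k; for j > k the truncated subtraction makes the
    coefficient of t^j zero. *)
Definition graded_le k (q : {poly {poly D}}) := forall j, (size (q`_j)%R <= k.+1 - j)%N.

Lemma graded_leM a b p q : graded_le a p -> graded_le b q -> graded_le (a + b) (p * q).
Proof.
move=> Hp Hq j; rewrite coefM; apply: (leq_trans (size_sum _ _ _)).
apply/bigmax_leqP => i _; have := Hp i; have := Hq (j - i)%N.
have [->|p0] := eqVneq p`_i 0; first by rewrite mul0r size_poly0.
have [->|q0] := eqVneq q`_(j - i) 0; first by rewrite mulr0 size_poly0.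
rewrite size_mul //; move: p0 q0; rewrite -!size_poly_gt0.
by move: (size p`_i)%R (size q`_(j - i))%R (ltn_ord i) => a1 b1; lia.
Qed.

Lemma graded_le_const c : graded_le 0 c%:P%:P.
Proof.
case=> [|j]; rewrite coefC /=; first exact: size_polyC_leq1.
by rewrite size_poly0.
Qed.

Lemma graded_le_var i : graded_le 1 (pencil_var i).
Proof.
rewrite /pencil_var; case: eqP => _ j.
  by rewrite coefC; case: j => [|j]; rewrite ?size_polyX ?size_poly0.
rewrite coefZ coefX; case: j => [|[|j]]; rewrite ?mulr0 ?size_poly0 // mulr1.
exact: size_polyC_leq1.
Qed.

(** A monomial of degree d becomes a scalar times a product of d factors, each X or t y_i. Hence for
    j > 0 the coefficient of t^j has degree less than k in X, as the uniqueness in Hensel's lemma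
    requires. *)
Lemma graded_le_pencil k p : (msize p <= k.+1)%N -> graded_le k (pencil p).
Proof.
move=> szp j; rewrite /pencil /mmap coef_sum; apply: (leq_trans (size_sum _ _ _)).
apply/bigmax_leqP_seq => m mp _.
suff H : graded_le (mdeg m) ((lift p@_m)%:P%:P * mmap1 pencil_var m).
  by apply: (leq_trans (H j)); have := leq_trans (msize_mdeg_lt mp) szp; lia.
rewrite -[mdeg m]add0n; apply: graded_leM; first exact: graded_le_const.
rewrite /mmap1 mdegE; apply: (big_rec2 (fun q d => graded_le d q)).
  exact: graded_le_const.
move=> i q d _ Hq; apply: graded_leM => //; elim: (m i) => [|e IH].
  exact: graded_le_const.
by rewrite exprS -add1n; apply: graded_leM => //; apply: graded_le_var.
Qed.

End Pencil.

Lemma factorization_unique (F : fieldType) (n k : nat) (f g f' g' : {mpoly F[n.+1]}) :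
  (msize f <= k.+1)%N -> (msize f' <= k.+1)%N ->
  size (on_axis ord0 f) = k.+1 -> coprimep (on_axis ord0 f) (on_axis ord0 g) ->
  on_axis ord0 f = on_axis ord0 f' -> f * g = f' * g' -> f = f'.
Proof.
move=> szf szf' sz0 fg0 E fg.
(* Generic values: with y_i the i-th variable itself, setting t = 1 and X = x_0 gives back the
   polynomial. *)
pose lift : {rmorphism F -> {mpoly F[n.+1]}} := @mpolyC n.+1 F.
pose y (i : 'I_n.+1) : {mpoly F[n.+1]} := 'X_i.
have mmap_id p : mmap lift y p = p.
  rewrite [RHS]mpolyE; apply: eq_bigr => m _.
  by rewrite -mul_mpolyC mmap1_id.
suff Ep : pencil lift y f = pencil lift y f'.
  have E1 := pencil1 lift y f; have E2 := pencil1 lift y f'.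
  by rewrite Ep E2 !mmap_id in E1.
(* This is [on_axis ord0], presented as a ring morphism. *)
pose ax : {rmorphism {mpoly F[n.+1]} -> {poly F}} := mmap polyC (fun j : 'I_n.+1 => if j == ord0 then 'X else 0).
apply: (@hensel_lift _ _ _ (pencil lift y) ax lift k f g f' g') => //.
  exact: pencil_coef0.
move=> j j0; have le_k : (k.+1 - j <= k)%N by lia.
by split; apply: leq_trans le_k; apply: graded_le_pencil.
Qed.

(** * Characteristic polynomials and perturbation of singular pencils *)

Lemma poly_eq0_off0 (F : numFieldType) (p : {poly F}) :
  (forall t, t != 0 -> p.[t] = 0) -> p = 0.
Proof.
move=> H; apply: (@roots_geq_poly_eq0 _ p [seq i%:R | i <- iota 1 (size p)]).
- apply/allP => _ /mapP[i + ->]; rewrite mem_iota => /andP[i0 _].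
  by apply/eqP/H; rewrite pnatr_eq0 -lt0n.
- rewrite map_inj_uniq ?iota_uniq // => i j /eqP; rewrite eqr_nat => /eqP.
  by [].
- by rewrite size_map size_iota.
Qed.

Lemma horner_det (F : fieldType) d (M : 'M[{poly F}]_d) t :
  (\det M).[t] = \det (map_mx (fun p => p.[t]) M).
Proof. by rewrite -[LHS]/(horner_eval t (\det M)) -det_map_mx. Qed.

(** For t != 0 one has t - M = -t (t^-1 M - 1), so the determinant on the axis is, up to sign, the
    characteristic polynomial with coefficients reversed. Its value at 0 shows that the
    proportionality constant is the product of the alpha_j. *)
Lemma char_poly_of_axis (F : numFieldType) k (M : 'M[F]_k) (alpha : 'I_k -> F) :
  (forall j, alpha j != 0) ->
  \det ('X *: map_mx polyC M - 1%:M) %= \prod_j ('X - ((alpha j)^-1)%:P) ->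
  char_poly M = \prod_j ('X - (alpha j)%:P).
Proof.
move=> a0 /eqpf_eq[c c0 E].
have Et t : \det (t *: M - 1%:M) = c * \prod_j (t - (alpha j)^-1).
  have := congr1 (horner^~ t) E; rewrite horner_det hornerZ horner_prod.
  under [in RHS]eq_bigr do rewrite hornerXsubC.
  move=> <-; congr (\det _); apply/matrixP => i j.
  by rewrite !mxE !(hornerE, hornerMn).
have c_E : c = \prod_j alpha j.
  have := Et 0; rewrite scale0r sub0r -scaleN1r detZ det1 mulr1.
  under eq_bigr do rewrite sub0r -mulN1r.
  rewrite big_split /= prodr_const card_ord mulrCA -[LHS]mulr1 => /mulfI H.
  have pa0 : \prod_j alpha j != 0 by apply/prodf_neq0.
  apply: (mulIf (invr_neq0 pa0)); rewrite mulfV // -prodfV; apply/esym/H.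
  by rewrite signr_eq0.
apply/eqP; rewrite -subr_eq0; apply/eqP/poly_eq0_off0 => t t0.
rewrite hornerD hornerN horner_det horner_prod.
have -> : map_mx (fun p => p.[t]) (char_poly_mx M) = - t *: (t^-1 *: M - 1%:M).
  apply/matrixP => i j; rewrite !mxE !(hornerE, hornerMn).
  by case: (i == j); field.
rewrite detZ Et c_E -big_split -[X in (- t) ^+ X]card_ord -prodr_const -big_split /=.
apply/eqP; rewrite subr_eq0; apply/eqP; apply: eq_bigr => j _.
by rewrite hornerXsubC; field; rewrite t0 a0.
Qed.

(* A polynomial kernel vector of diag(delta) + t E is compared at its lowest
   degree j in t and at degrees j + 1 and j + 2. *)
Lemma singular_pencil (F : numFieldType) d (delta : 'I_d -> F) (E : 'M[F]_d) p :
  delta p = 0 -> (forall q, q != p -> delta q != 0) ->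
  (forall t, \det (diag_mx (\row_q delta q) + t *: E) = 0) ->
  E p p = 0 /\ \sum_(q | q != p) E p q * E q p / delta q = 0.
Proof.
move=> dp dq Ht.
pose M : 'M[{poly F}]_d := map_mx polyC (diag_mx (\row_q delta q)) + 'X *: map_mx polyC E.
(* The determinant vanishes at all nonzero scalars, hence as a polynomial; a singular matrix over
   the domain F[t] has a nonzero kernel vector with polynomial entries. *)
have /eqP/det0P[v v0 vM] : \det M = 0.
  apply: poly_eq0_off0 => t _; rewrite horner_det -[RHS](Ht t); congr (\det _).
  by apply/matrixP => i j; rewrite !mxE !(hornerE, hornerMn).
pose c q m := (v 0 q)`_m.
have vMq q : v 0 q * (delta q)%:P + 'X * (\sum_r v 0 r * (E r q)%:P) = 0.
  have /rowP/(_ q) := vM; rewrite !mxE; apply: etrans.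
  rewrite mulr_sumr; under [RHS]eq_bigr do rewrite !mxE mulrDr.
  rewrite big_split /= [X in _ = X + _](bigD1 q) //= eqxx mulr1n [X in _ = _ + X + _]big1 ?addr0; last first.
    by move=> r /negPf ->; rewrite mulr0n polyC0 mulr0.
  by congr (_ + _); apply: eq_bigr => r _; rewrite mulrCA.
have H0 q : c q 0%N * delta q = 0.
  by have := congr1 (fun f : {poly F} => f`_0) (vMq q); rewrite coefD coefMC coefXM coef0 addr0.
have HS q m : c q m.+1 * delta q + \sum_r c r m * E r q = 0.
  have := congr1 (fun f : {poly F} => f`_m.+1) (vMq q).
  rewrite coefD coefMC coefXM coef0 coef_sum /= => {2}<-; congr (_ + _).
  by apply: eq_bigr => r _; rewrite coefMC.
have exj : exists j, [exists q, c q j != 0].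
  have /rV0Pn[q vq] := v0; exists (size (v 0 q)).-1; apply/existsP; exists q.
  by rewrite -[c _ _]/(lead_coef _) lead_coef_eq0.
case: (ex_minnP exj) => j /existsP[q0 cq0] jmin.
have lo q m : (m < j)%N -> c q m = 0.
  move=> mj; apply/eqP; apply: contraTT mj => cqm; rewrite -leqNgt jmin //.
  by apply/existsP; exists q.
have cj q : q != p -> c q j = 0.
  move=> qp; apply: (mulIf (dq q qp)); rewrite mul0r.
  case: (j) (lo) => [//|m] lom; have := HS q m; rewrite big1 ?addr0 // => r _.
  by rewrite lom // mul0r.
have cp : c p j != 0.
  by apply: contraNneq cq0 => cp; have [->|/cj ->] := eqVneq q0 p; rewrite ?cp.
have Hj q : c q j.+1 * delta q + c p j * E p q = 0.
  rewrite -[RHS](HS q j) (bigD1 p) //= [X in _ + (_ + X)]big1 ?addr0 //.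
  by move=> r /cj ->; rewrite mul0r.
have Epp : E p p = 0.
  by have := Hj p; rewrite dp mulr0 add0r => /eqP; rewrite mulf_eq0 (negPf cp) => /eqP.
split=> //; have := HS p j.+1; rewrite dp mulr0 add0r (bigD1 p) //= Epp mulr0 add0r.
move=> S; apply: (mulfI (_ : - c p j != 0)); first by rewrite oppr_eq0.
rewrite mulr0 -[RHS]S mulr_sumr; apply: eq_bigr => q qp.
have -> : c q j.+1 = - c p j * E p q / delta q.
  apply: (mulIf (dq q qp)); rewrite divfK ?dq //.
  by apply/eqP; rewrite -subr_eq0 mulNr opprK Hj.
by ring.
Qed.

(** Here mu lists the eigenvalues of wedge^k A_1, B is wedge^k A_i in an orthonormal eigenbasis, b =
    a_i and D = det A_1. Solving each line for x gives a singular pencil in t, with delta_q equal to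
    mu_q / mu_p - 1 in the first case and mu_p / mu_q - 1 in the second. *)
Lemma eigenrow_of_hyperplanes (C : numClosedFieldType) d (mu : 'I_d -> C)
    (B : 'M[C]_d) p (b D : C) :
  D != 0 -> (forall q, mu q != 0) -> (forall q, q != p -> mu q != mu p) ->
  (forall q, B q p = (B p q)^*) ->
  (forall x t, mu p * x + b * t = 1 ->
     \det (x *: diag_mx (\row_q mu q) + t *: B - 1%:M) = 0) ->
  (forall x t, D / mu p * x + b * t = 1 ->
     \det (x *: diag_mx (\row_q (D / mu q)) + t *: B - 1%:M) = 0) ->
  row p B = b *: delta_mx 0 p.
Proof.
move=> D0 mu0 mup herm H1 H2.
have [|q qp||Epp1 S1] := @singular_pencil _ d (fun q => mu q / mu p - 1)
    (B - diag_mx (\row_q (b * mu q / mu p))) p.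
- by rewrite divff ?subrr.
- by rewrite subr_eq0 -(inj_eq (mulIf (mu0 p))) divfK // mul1r mup.
- move=> t; have := H1 ((1 - b * t) / mu p) t; rewrite mulrC divfK // subrK.
  move=> /(_ erefl) E; rewrite -[RHS]E; congr (\det _); apply/matrixP => i j.
  by rewrite !mxE; case: (i == j); field.
have [|q qp||Epp2 S2] := @singular_pencil _ d (fun q => mu p / mu q - 1)
    (B - diag_mx (\row_q (b * mu p / mu q))) p.
- by rewrite divff ?subrr.
- by rewrite subr_eq0 -(inj_eq (mulIf (mu0 q))) divfK // mul1r eq_sym mup.
- move=> t; have := H2 ((1 - b * t) / (D / mu p)) t.
  rewrite mulrC divfK ?mulf_neq0 ?invr_eq0 // subrK.
  move=> /(_ erefl) E; rewrite -[RHS]E; congr (\det _); apply/matrixP => i j.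
  by rewrite !mxE; case: (i == j); field; rewrite ?D0 ?mu0.
(* With r = mu q / mu p, 1/(r - 1) + 1/(1/r - 1) = -1, so the two second-order identities add up to
   minus this sum of squared moduli. *)
have S : \sum_(q | q != p) B p q * (B p q)^* = 0.
  have := congr2 +%R S1 S2; rewrite addr0 -big_split => S12.
  apply: oppr_inj; rewrite oppr0 -[RHS]S12 -sumrN.
  apply: eq_bigr => q qp; rewrite !mxE (negPf qp) eq_sym (negPf qp) !subr0 herm.
  rewrite /=; field.
  by rewrite !mulN1r !subr_eq0 !mu0 [mu p == _]eq_sym !mup.
have Bpq q : q != p -> B p q = 0.
  move=> qp; apply/eqP; rewrite -mul_conjC_eq0; apply/eqP.
  by apply: (psumr_eq0P _ S) => // r _; apply: mul_conjC_ge0.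
apply/rowP => q; rewrite !mxE eqxx /=; have [->|qp] := eqVneq q p.
  move: Epp1; rewrite !mxE eqxx mulr1n mulfK // => /eqP; rewrite subr_eq0 => /eqP ->.
  by rewrite mulr1.
by rewrite mulr0 Bpq.
Qed.

(** * Exterior powers and decomposable vectors *)

Section Wedge.

Variables (C : numClosedFieldType) (N k : nat).
Implicit Types (V : 'M[C]_(k, N)) (A : 'M[C]_N).

(** If V is a basis of an invariant subspace and Z the restricted operator, this makes [wedge V] an
    eigenvector with eigenvalue det Z. *)
Lemma wedge_mull (Z : 'M[C]_k) V : wedge (Z *m V) = \det Z *: wedge V.
Proof.
apply/rowP => q; rewrite !mxE -det_mulmx; congr (\det _).
by apply/matrixP => a b; rewrite !mxE; apply: eq_bigr => j _; rewrite !mxE.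
Qed.

Lemma row_extpow A p : row p (extpow k A) = wedge (rowsub (tnth (basis_tuple p)) A).
Proof. by apply/rowP => q; rewrite !mxE. Qed.

Lemma extpow1 : extpow k (1%:M : 'M[C]_N) = 1%:M.
Proof. by apply/row_matrixP => p; rewrite row_extpow wedge_basis row1. Qed.

Lemma extpowM A (B : 'M_N) : extpow k (A *m B) = extpow k A *m extpow k B.
Proof.
apply/row_matrixP => p; rewrite row_mul !row_extpow -wedge_mulmx.
by rewrite mul_rowsub_mx.
Qed.

Lemma extpow_unit A : A \in unitmx -> extpow k A \in unitmx.
Proof.
move=> uA; have := extpow1; rewrite -(mulmxV uA) extpowM => /mulmx1_unit.
by case.
Qed.

Lemma extpow_diag (d : 'I_N -> C) :
  extpow k (diag_mx (\row_i d i)) =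
  diag_mx (\row_p \prod_j d (tnth (basis_tuple p) j)).
Proof.
apply/row_matrixP => p; rewrite row_extpow row_diag_mx mxE.
have -> : rowsub (tnth (basis_tuple p)) (diag_mx (\row_i d i)) =
   diag_mx (\row_j d (tnth (basis_tuple p) j)) *m rowsub (tnth (basis_tuple p)) 1%:M.
  by apply/matrixP => i j; rewrite mul_diag_mx !mxE -mulr_natr.
rewrite wedge_mull wedge_basis det_diag; congr (_ *: _).
by apply: eq_bigr => j _; rewrite mxE.
Qed.

(** If all maximal minors vanished, Cauchy-Binet for V and a right inverse of V would give 1 = 0. *)
Lemma wedge_row_free V : row_free V -> wedge V != 0.
Proof.
move=> /row_freeP[B VB]; apply/eqP => w0.
have := cauchy_binet V B; rewrite VB det1 w0 big1; first by move/eqP; rewrite oner_eq0.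
by move=> p _; rewrite mxE mul0r.
Qed.

(* If V *m c = 0 but V' *m c <> 0, then some W has V' *m W = 1, and
   subtracting from W a suitable matrix with columns proportional to c makes
   V' *m W singular without changing V *m W. *)
Lemma wedge_colinear_sub (a : C) V V' :
  a != 0 -> row_free V -> wedge V' = a *: wedge V -> (V' <= V)%MS.
Proof.
move=> a0 /row_freeP[B VB] E.
(* By Cauchy-Binet, the wedge of V determines det(V W) for every W. *)
have detE W : \det (V' *m W) = a * \det (V *m W).
  rewrite !cauchy_binet mulr_sumr; apply: eq_bigr => p _.
  by rewrite E mxE mulrA.
have [W V'W] : exists W, V' *m W = 1%:M.
  have u : V' *m B \in unitmx by rewrite unitmxE detE VB det1 mulr1 unitfE.
  by exists (B *m invmx (V' *m B)); rewrite mulmxA mulmxV.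
rewrite submxE; apply/eqP/matrixP => i j; rewrite [RHS]mxE; apply: contraTeq isT => nz.
pose c := col j (cokermx V).
have Vc : V *m c = 0 by rewrite /c colE mulmxA mulmx_coker mul0mx.
pose x := V' *m c.
have xi : x i 0 != 0 by rewrite /x /c colE mulmxA -colE mxE.
pose u : 'rV_k := (x i 0)^-1 *: delta_mx 0 i.
have ux : u *m x = 1%:M.
  apply/matrixP => s t; rewrite !ord1 -scalemxAl -rowE mxE [row _ _ _ _]mxE [RHS]mxE.
  by rewrite mulVf.
have : \det (V' *m (W - c *m u)) = 0.
  apply/eqP/det0P; exists u.
    by apply: contra_eq_neq ux => ->; rewrite mul0mx eq_sym oner_neq0.
  by rewrite mulmxBr V'W mulmxA -/x mulmxBr mulmx1 mulmxA ux mul1mx subrr.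
rewrite detE mulmxBr mulmxA Vc mul0mx subr0 -detE V'W det1 => /eqP.
by rewrite oner_eq0.
Qed.

End Wedge.

(** * Change of basis and invariant subspaces *)

(** The ring is arbitrary so that the lemma applies both to polynomials in all the variables and to
    univariate ones on an axis. *)
Lemma det_pencil_intertwine (D : comNzRingType) n d (x : 'I_n -> D) (U V : 'M[D]_d)
    (A B : 'I_n -> 'M[D]_d) :
  V *m U = 1%:M -> (forall i, U *m A i = B i *m U) ->
  \det (\sum_i x i *: A i - 1%:M) = \det (\sum_i x i *: B i - 1%:M).
Proof.
move=> VU UA; have dVU : \det V * \det U = 1 by rewrite -det_mulmx VU det1.
rewrite -[LHS]mul1r -{1}dVU -mulrA -det_mulmx.
have -> : U *m (\sum_i x i *: A i - 1%:M) = (\sum_i x i *: B i - 1%:M) *m U.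
  rewrite mulmxBr mulmxBl mulmx1 mul1mx mulmx_sumr mulmx_suml; congr (_ - _).
  by apply: eq_bigr => i _; rewrite -scalemxAr -scalemxAl UA.
by rewrite det_mulmx mulrCA dVU mulr1.
Qed.

Section DetPoly.

Variables (F : fieldType) (n : nat).

Lemma eq_det_poly d (A B : 'I_n -> 'M[F]_d) : A =1 B -> det_poly A = det_poly B.
Proof. by move=> AB; rewrite /det_poly; under eq_bigr => i _ do rewrite AB. Qed.

Lemma det_poly_intertwine d (U : 'M[F]_d) (A B : 'I_n -> 'M[F]_d) :
  U \in unitmx -> (forall i, U *m A i = B i *m U) -> det_poly A = det_poly B.
Proof.
move=> uU UA; apply: (@det_pencil_intertwine _ _ _ _ (map_mx (@mpolyC n F) U)
    (map_mx (@mpolyC n F) (invmx U))).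
  by rewrite -map_mxM mulVmx // map_mx1.
by move=> i; rewrite -!map_mxM UA.
Qed.

(** Matrices act on rows, so a zero upper right block means that the first k basis vectors span an
    invariant subspace. *)
Lemma det_poly_block k l (A : 'I_n -> 'M[F]_(k + l)) :
  (forall i, ursubmx (A i) = 0) ->
  det_poly A = det_poly (fun i => ulsubmx (A i)) * det_poly (fun i => drsubmx (A i)).
Proof.
move=> A0; pose S := \sum_i 'X_i *: map_mx (@mpolyC n F) (dlsubmx (A i)).
rewrite /det_poly -(det_lblock _ S); congr (\det _); rewrite -[LHS]submxK.
congr block_mx; apply/matrixP => i j.
- by rewrite !mxE (inj_eq (@lshift_inj _ _)) !summxE; congr (_ - _);
    apply: eq_bigr => s _; rewrite !mxE.
- rewrite !mxE eq_lrshift subr0 summxE big1 // => s _.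
  by have /matrixP/(_ i j) := A0 s; rewrite !mxE => ->; rewrite mpolyC0 mulr0.
- rewrite !mxE eq_rlshift subr0 !summxE.
  by apply: eq_bigr => s _; rewrite !mxE.
- by rewrite !mxE (inj_eq (@rshift_inj _ _)) !summxE; congr (_ - _);
    apply: eq_bigr => s _; rewrite !mxE.
Qed.

(** In a basis that starts with the rows of W, every A_i is block triangular with upper left block
    Z_i. *)
Lemma det_poly_stable N k (A : 'I_n -> 'M[F]_N) (W : 'M_(k, N)) (Z : 'I_n -> 'M_k) :
  row_free W -> (forall i, Z i *m W = W *m A i) ->
  exists g, det_poly A = det_poly Z * g.
Proof.
move=> fW ZW; have [l Nkl] : exists l, N = (k + l)%N.
  by exists (N - k)%N; rewrite subnKC // -(eqP fW) rank_leq_col.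
subst N.
have rW : \rank (W^C)%MS = l by rewrite mxrank_compl (eqP fW) addKn.
(* A basis of a complement of W, cast to have exactly l rows. *)
pose W2 := castmx (rW, erefl) (row_base W^C%MS).
pose U : 'M_(k + l) := col_mx W W2.
have uU : U \in unitmx.
  rewrite -row_full_unit -sub1mx; have := addsmx_compl_full W; rewrite -sub1mx.
  move=> H; apply: (submx_trans H); rewrite -addsmxE addsmxS //.
  by rewrite eqmx_cast eq_row_base.
pose B i := U *m A i *m invmx U.
have UA i : U *m A i = B i *m U by rewrite mulmxKV.
have BE i : usubmx (B i) = row_mx (Z i) 0.
  have := UA i; rewrite mul_col_mx -[B i]vsubmxK mul_col_mx => /eq_col_mx[+ _].
  rewrite -ZW => E; apply: (row_free_inj (_ : row_free U)).
    by rewrite row_free_unit.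
  by rewrite col_mxKu -E mul_row_col mul0mx addr0.
have ur0 i : ursubmx (B i) = 0 by rewrite /ursubmx BE row_mxKr.
have ulZ : det_poly (fun i => ulsubmx (B i)) = det_poly Z.
  by apply: eq_det_poly => i; rewrite /ulsubmx BE row_mxKl.
exists (det_poly (fun i => drsubmx (B i))).
by rewrite (det_poly_intertwine uU UA) (det_poly_block ur0) ulZ.
Qed.

End DetPoly.

Lemma char_poly_intertwine (F : fieldType) d (U A B : 'M[F]_d) :
  U \in unitmx -> U *m A = B *m U -> char_poly A = char_poly B.
Proof.
move=> uU UA; pose mU := map_mx polyC U.
have dU : \det mU != 0 by rewrite det_map_mx /= polyC_eq0 -unitfE -unitmxE.
apply: (mulfI dU); rewrite -det_mulmx mulrC -det_mulmx; congr (\det _).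
by rewrite /char_poly_mx mulmxBr mulmxBl -!map_mxM UA scalar_mxC.
Qed.

(** * Eigenvectors of the dual exterior power *)

Section DualExtpow.

Variables (C : numClosedFieldType) (N k : nat) (A : 'M[C]_N).
Hypotheses (kN : (k <= N)%N) (hA : A \is hermsymmx) (uA : A \in unitmx).

(** After multiplication by the invertible [extpow k A], this follows from [dual_extpow_mul]. *)
Lemma dual_extpow_eigen (v : 'rV[C]_(ext_dim N k)) a : a != 0 ->
  v *m extpow k A = a *: v -> v *m dual_extpow k A = (\det A / a) *: v.
Proof.
move=> a0 E; have uE := extpow_unit k uA.
apply: (row_free_inj (_ : row_free (extpow k A))); first by rewrite row_free_unit.
rewrite -mulmxA dual_extpow_mul // -scalemxAl E scalerA divfK //.
by rewrite mul_mx_scalar.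
Qed.

(** This lets both hyperplane conditions be read in one eigenbasis. *)
Lemma dual_extpow_diag (mu : 'I_(ext_dim N k) -> C) (V : 'M_(ext_dim N k)) :
  V \in unitmx -> V *m extpow k A = diag_mx (\row_q mu q) *m V ->
  (forall q, mu q != 0) ->
  V *m dual_extpow k A = diag_mx (\row_q (\det A / mu q)) *m V.
Proof.
move=> uV E mu0; apply/row_matrixP => q; rewrite !row_mul row_diag_mx !mxE.
rewrite -scalemxAl -rowE; apply: dual_extpow_eigen => //.
by rewrite -row_mul E row_mul row_diag_mx !mxE -scalemxAl -rowE.
Qed.

End DualExtpow.

(** * From an induced representation to the hyperplanes *)

(** At a point x of the hyperplane, v is in the kernel of the pencil, because the b_i x_i add up to
    1. *)
Lemma hyperplane_sub_det_poly (F : fieldType) n d (B : 'I_n -> 'M[F]_d)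
    (b : 'I_n -> F) (v : 'rV_d) :
  v != 0 -> (forall i, v *m B i = b i *: v) ->
  hypersurface_sub (hyperplane b) (det_poly B).
Proof.
move=> v0 vB x; rewrite /on_hypersurface meval_hyperplane => /eqP; rewrite subr_eq0 => /eqP bx.
rewrite meval_det_poly; apply/eqP/det0P; exists v => //.
rewrite mulmxBr mulmx1 mulmx_sumr -[X in _ - X]scale1r -bx scaler_suml.
apply/eqP; rewrite subr_eq0; apply/eqP; apply: eq_bigr => i _.
by rewrite -scalemxAr vB scalerA mulrC.
Qed.

Lemma conjmx_mulmx (F : fieldType) N k (W : 'M[F]_(k, N)) A :
  stablemx W A -> conjmx W A *m W = W *m A.
Proof. by move=> /mulmxKpV. Qed.

Lemma on_axis_unit (F : fieldType) n (u : {mpoly F[n]}) i :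
  u \is a GRing.unit -> on_axis i u \is a GRing.unit.
Proof. exact: rmorph_unit. Qed.

Lemma on_axis_associated (F : fieldType) n (P Q : {mpoly F[n]}) i :
  associated P Q -> on_axis i P %= on_axis i Q.
Proof.
move=> [u uu ->].
have -> : on_axis i (u * Q) = on_axis i u * on_axis i Q by exact: rmorphM.
have := on_axis_unit i uu; rewrite poly_unitE => /andP[/size_poly1P[c c0 ->] _].
by rewrite mul_polyC eqp_scale.
Qed.

(** The vector is the wedge of a basis of L. Its eigenvalue det(A_i|L) is read off the constant term
    of the characteristic polynomial of A_i|L, whose roots are known from the x_i-axis. *)
Lemma hyperplanes_of_representation (C : numClosedFieldType) n N k
    (Q : {mpoly C[n.+1]}) (alpha : 'I_n.+1 -> 'I_k -> C) (A : 'I_n.+1 -> 'M[C]_N) :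
  (forall i j, alpha i j != 0) ->
  (forall i, on_axis i Q %= \prod_(j < k) ('X - ((alpha i j)^-1)%:P)) ->
  A ord0 \is hermsymmx -> A ord0 \in unitmx -> induces_representation A Q k ->
  exists2 v : 'rV[C]_(ext_dim N k), v != 0 &
    (forall i, v *m extpow k (A i) = (\prod_j alpha i j) *: v) /\
    v *m dual_extpow k (A ord0) = (\det (A ord0) / \prod_j alpha ord0 j) *: v.
Proof.
move=> alpha0 Qax hA uA [L [rL stL detL]].
have kN : (k <= N)%N by rewrite -rL rank_leq_col.
(* [row_base L] has [\rank L] rows; a basis with k rows in its type is needed to form its wedge in
   the k-th power. *)
suff [W [fW stW dW]] : exists W : 'M[C]_(k, N),
    [/\ row_free W, forall i, stablemx W (A i)
      & determinantal_representation Q (fun i => conjmx W (A i))].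
  have eig i : wedge W *m extpow k (A i) = (\prod_j alpha i j) *: wedge W.
    rewrite -wedge_mulmx -conjmx_mulmx // wedge_mull; congr (_ *: _).
    have := on_axis_associated i dW; rewrite eqp_sym => /eqp_trans/(_ (Qax i)).
    rewrite on_axis_det_poly => /(char_poly_of_axis (alpha0 i)) E.
    have := char_poly_det (conjmx W (A i)).
    rewrite E -(big_map (alpha i) predT (fun z => 'X - z%:P)) coef0_prod_XsubC.
    rewrite size_map -[index_enum _]enumT size_enum_ord big_map => /mulfI -> //.
    by rewrite signr_eq0.
  exists (wedge W); first exact: wedge_row_free.
  split=> //; apply: dual_extpow_eigen => //; exact/prodf_neq0.
have fL := row_base_free L.
have stB i : stablemx (row_base L) (A i) by rewrite stablemx_row_base.
move: (row_base L) fL stB detL; rewrite rL => W fW stW dW.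
by exists W.
Qed.

(** * Recognizing a factor by its restriction to the axis *)

(** On the axis f agrees with Q up to a scalar c, so uniqueness is applied to f g = (c Q)(c^-1 Q').
    Over an algebraically closed field, coprimality on the axis amounts to having no common root. *)
Lemma associated_of_axis (F : closedFieldType) n k (f g Q Q' : {mpoly F[n.+1]}) :
  (msize f <= k.+1)%N -> (msize Q <= k.+1)%N -> size (on_axis ord0 Q) = k.+1 ->
  on_axis ord0 f %= on_axis ord0 Q ->
  (forall x, root (on_axis ord0 Q) x -> (on_axis ord0 Q').[x] != 0) ->
  f * g = Q * Q' -> associated Q f.
Proof.
move=> szf szQ szax /eqpf_eq[c c0 Ec] rootQ fg.
have axM (p q : {mpoly F[n.+1]}) : on_axis ord0 (p * q) = on_axis ord0 p * on_axis ord0 q.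
  exact: rmorphM.
have axZ b p : on_axis ord0 (b *: p) = b *: on_axis ord0 p.
  by rewrite /on_axis mmapZ mul_polyC.
have ax0 : on_axis ord0 Q != 0 by rewrite -size_poly_gt0 szax.
have gE : on_axis ord0 g = c^-1 *: on_axis ord0 Q'.
  have := congr1 (on_axis ord0) fg; rewrite !axM Ec -scalerAl => E.
  by apply: (mulfI ax0); rewrite -scalerAr -E scalerA mulVf // scale1r.
suff fE : f = c *: Q.
  exists (c^-1)%:MP.
    apply/unitrP; exists c%:MP; rewrite -!rmorphM /=.
    by rewrite mulVf // mulfV.
  by rewrite fE mul_mpolyC scalerA mulVf // scale1r.
apply: (@factorization_unique F n k f g (c *: Q) (c^-1 *: Q')) => //.
- exact: leq_trans (msizeZ_le _ _) szQ.
- by rewrite Ec size_scale.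
- rewrite Ec gE coprimepZl // coprimepZr ?invr_eq0 //.
  exact: Pdiv.ClosedField.root_coprimep.
- by rewrite axZ.
- by rewrite -scalerAl -scalerAr scalerA mulfV // scale1r.
Qed.

(** * The common eigenvector of the exterior powers *)

(** By unique factorization the divisor is a product over a subset of the indices; sorting that
    subset gives the increasing tuple p. *)
Lemma basis_tuple_of_dvdp (C : numClosedFieldType) N k (d : 'I_N -> C) (c : 'I_k -> C) :
  \prod_j ('X - (c j)%:P) %| \prod_i ('X - (d i)%:P) ->
  exists p : 'I_(ext_dim N k),
    \prod_j ('X - (c j)%:P) = \prod_j ('X - (d (tnth (basis_tuple p) j))%:P).
Proof.
move=> /dvdp_prod_XsubC[m]; set w := mask m _.
rewrite eqp_monic ?monic_prod_XsubC // => /eqP E.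
have sw : size w = k.
  have := congr1 (fun f : {poly C} => size f) E; rewrite !size_prod_XsubC => -[<-].
  by rewrite -[index_enum _]enumT size_enum_ord.
have uw : uniq w by apply: mask_uniq; apply: index_enum_uniq.
have [p wp] := basis_tuple_ex uw sw; exists p.
by rewrite E (perm_big _ wp) /= big_tuple.
Qed.

Lemma mup_prod_XsubC1 (F : fieldType) d (mu : 'I_d -> F) p :
  mup (mu p) (\prod_q ('X - (mu q)%:P)) = 1%N -> forall q, q != p -> mu q != mu p.
Proof.
move=> mup1 q qp; apply/eqP => E; move: mup1.
rewrite -(big_map mu predT (fun z => 'X - z%:P)) mu_prod_XsubC count_map => c1.
have : (size [:: q; p] <= 1)%N; last by [].
rewrite -c1 -size_filter; apply: uniq_leq_size; first by rewrite /= inE qp.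
move=> r; rewrite !inE mem_filter /= mem_index_enum andbT => /orP[] /eqP -> //.
by rewrite E.
Qed.

Lemma hermitian_conj (C : numClosedFieldType) N (A : 'M[C]_N) :
  A \is hermsymmx -> map_mx Num.conj A = A^T.
Proof.
rewrite is_hermitianmxE expr0 scale1r => /eqP hA.
by apply/matrixP => a b; rewrite [in RHS]hA !mxE.
Qed.

Section CommonEigenvector.

Variables (C : numClosedFieldType) (n N k : nat) (A : 'I_n.+1 -> 'M[C]_N).
Variables (a : 'I_n.+1 -> C) (d : 'I_N -> C) (U : 'M[C]_N) (p : 'I_(ext_dim N k)).

Hypothesis kN : (k <= N)%N.
Hypothesis hA : forall i, A i \is hermsymmx.
Hypothesis uA : A ord0 \in unitmx.
Hypothesis unitaryU : U *m (map_mx Num.conj U)^T = 1%:M.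
Hypothesis UA : U *m A ord0 = diag_mx (\row_i d i) *m U.

Let mu (q : 'I_(ext_dim N k)) := \prod_j d (tnth (basis_tuple q) j).

Hypothesis mu_p : mu p = a ord0.
Hypothesis mup_a : mup (a ord0) (char_poly (extpow k (A ord0))) = 1%N.

Hypothesis sub1 :
  hypersurface_sub (hyperplane a) (det_poly (fun i => extpow k (A i))).
Hypothesis sub2 :
  hypersurface_sub
    (hyperplane (fun i => if i == ord0 then \det (A ord0) / a ord0 else a i))
    (det_poly (fun i =>
       if i == ord0 then dual_extpow k (A ord0) else extpow k (A i))).

Lemma wedge_common_eigenvector i :
  wedge (rowsub (tnth (basis_tuple p)) U) *m extpow k (A i) =
  a i *: wedge (rowsub (tnth (basis_tuple p)) U).
Proof.
have uU : U \in unitmx by case: (mulmx1_unit unitaryU).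
have d0 j : d j != 0.
  have : \det (diag_mx (\row_i d i)) != 0.
    have : \det (U *m A ord0) != 0.
      by rewrite -unitfE -unitmxE unitmx_mul uU.
    by rewrite UA det_mulmx mulf_eq0 negb_or => /andP[].
  by rewrite det_diag => /prodf_neq0/(_ j isT); rewrite mxE.
have mu0 q : mu q != 0 by apply/prodf_neq0.
have D0 : \det (A ord0) != 0 by rewrite -unitfE -unitmxE.
pose V := extpow k U; have uV : V \in unitmx := extpow_unit k uU.
have VA : V *m extpow k (A ord0) = diag_mx (\row_q mu q) *m V.
  by rewrite -extpowM UA extpowM extpow_diag.
have Vd := dual_extpow_diag kN (hA ord0) uA uV VA mu0.
have rowV : row p V = wedge (rowsub (tnth (basis_tuple p)) U) by rewrite row_extpow.
rewrite -{}rowV; have [->|i0] := eqVneq i ord0.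
  by rewrite -row_mul VA row_mul row_diag_mx !mxE mu_p -scalemxAl -rowE.
pose B := V *m extpow k (A i) *m invmx V.
have VB : V *m extpow k (A i) = B *m V by rewrite mulmxKV.
suff rB : row p B = a i *: delta_mx 0 p.
  by rewrite -row_mul VB row_mul rB -scalemxAl -rowE.
(* The characteristic polynomial is computed in the eigenbasis, so multiplicity 1 says that no other
   index has the same eigenvalue. *)
have muNp q : q != p -> mu q != mu p.
  apply: mup_prod_XsubC1; rewrite mu_p -mup_a; congr (mup _ _).
  rewrite (char_poly_intertwine uV VA) char_poly_trig ?diag_mx_is_trig //.
  by apply: eq_bigr => r _; rewrite !mxE eqxx mulr1n.
(* The exterior power of a unitary matrix is unitary, so [B] is again hermitian. *)
have invV : invmx V = (map_mx Num.conj V)^T.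
  have VV : V *m (map_mx Num.conj V)^T = 1%:M.
    by rewrite -extpow_conj -extpow_tr -extpowM unitaryU extpow1.
  by rewrite -[LHS]mulmx1 -VV mulmxA mulVmx // mul1mx.
have hermB q : B q p = (B p q)^*.
  have : B^T = map_mx Num.conj B.
    rewrite /B invV !map_mxM -(extpow_conj k (A i)) (hermitian_conj (hA i)) extpow_tr map_trmx map_conjK.
    by rewrite !trmx_mul -map_trmx trmxK mulmxA.
  by move=> /matrixP/(_ p q); rewrite !mxE.
have det_conj M M' : V *m M = M' *m V -> \det M = 0 -> \det M' = 0.
  move=> VM dM; have := congr1 determinant VM; rewrite !det_mulmx dM mulr0.
  by move/esym/eqP; rewrite mulf_eq0 => /orP[/eqP|] //; rewrite (negPf (_ : \det V != 0)) // -unitfE -unitmxE.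
(* The hyperplanes are only cut with the plane of the x_0- and x_i-axes, where they become lines in
   (x, t). *)
pose pt x t (j : 'I_n.+1) := if j == ord0 then x else if j == i then t else 0 : C.
have sum_pt (M : lmodType C) x t (f : 'I_n.+1 -> M) :
    \sum_j pt x t j *: f j = x *: f ord0 + t *: f i.
  rewrite (bigD1 ord0) //= (bigD1 i) //= /pt eqxx (negPf i0) eqxx big1 ?addr0 //.
  by move=> j /andP[/negPf -> /negPf ->]; rewrite scale0r.
have sum_pt1 x t (b : 'I_n.+1 -> C) : \sum_j b j * pt x t j = b ord0 * x + b i * t.
  have := sum_pt C^o x t b; rewrite /GRing.scale /= ![_ ord0 * x]mulrC [_ * t]mulrC => <-.
  by apply: eq_bigr => j _; rewrite mulrC.
apply: (eigenrow_of_hyperplanes D0 mu0 muNp hermB) => x t xt.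
- have := sub1 (x := pt x t); rewrite /on_hypersurface meval_hyperplane sum_pt1.
  rewrite -mu_p xt subrr meval_det_poly sum_pt => /(_ erefl); apply: det_conj.
  rewrite mulmxBr mulmxBl mulmx1 mul1mx mulmxDr mulmxDl -!scalemxAr -!scalemxAl.
  by rewrite VA VB.
- have := sub2 (x := pt x t); rewrite /on_hypersurface meval_hyperplane sum_pt1.
  rewrite eqxx (negPf i0) -mu_p xt subrr meval_det_poly sum_pt => /(_ erefl).
  rewrite eqxx (negPf i0); apply: det_conj.
  rewrite mulmxBr mulmxBl mulmx1 mul1mx mulmxDr mulmxDl -!scalemxAr -!scalemxAl.
  by rewrite Vd VB.
Qed.

End CommonEigenvector.

(** * From the hyperplanes to an induced representation *)

Lemma on_axis_det_poly_diag (F : fieldType) n d (A : 'I_n -> 'M[F]_d) (U : 'M_d)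
    (lambda : 'I_d -> F) i :
  U \in unitmx -> U *m A i = diag_mx (\row_j lambda j) *m U ->
  (forall j, lambda j != 0) ->
  on_axis i (det_poly A) %= \prod_j ('X - ((lambda j)^-1)%:P).
Proof.
move=> uU UA l0; rewrite on_axis_det_poly.
have VU : map_mx polyC (invmx U) *m map_mx polyC U = 1%:M.
  by rewrite -map_mxM mulVmx // map_mx1.
(* A one-element index set turns the general pencil into X A_i - 1. *)
have mUA (_ : 'I_1) : map_mx polyC U *m map_mx polyC (A i) =
    map_mx polyC (diag_mx (\row_j lambda j)) *m map_mx polyC U.
  by rewrite -!map_mxM UA.
have := det_pencil_intertwine (fun=> 'X) VU mUA; rewrite !big_ord1 => ->.
have -> : 'X *: map_mx polyC (diag_mx (\row_j lambda j)) - 1%:M =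
    diag_mx (\row_j (lambda j *: ('X - ((lambda j)^-1)%:P))).
  apply/matrixP => s t; rewrite !mxE; have [->|_] := eqVneq s t; last first.
    by rewrite !mulr0n polyC0 mulr0 subrr.
  by rewrite !mulr1n scalerBr -!mul_polyC -polyCM mulfV // mulrC.
rewrite det_diag; under eq_bigr do rewrite mxE.
by rewrite scaler_prod eqp_scale //; apply/prodf_neq0.
Qed.

Lemma representation_of_hyperplanes (C : numClosedFieldType) n N k
    (Q Q' : {mpoly C[n.+1]}) (alpha : 'I_k -> C) (a : 'I_n.+1 -> C)
    (A : 'I_n.+1 -> 'M[C]_N) :
  (msize Q <= k.+1)%N ->
  (forall j, alpha j != 0) -> a ord0 = \prod_j alpha j -> (forall i, a i != 0) ->
  on_axis ord0 Q %= \prod_j ('X - ((alpha j)^-1)%:P) ->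
  (forall j, Q'.@[axis_point ord0 (alpha j)^-1] != 0) ->
  det_poly A = Q * Q' ->
  (forall i, A i \is hermsymmx) -> A ord0 \in unitmx ->
  mup (a ord0) (char_poly (extpow k (A ord0))) = 1%N ->
  hypersurface_sub (hyperplane a) (det_poly (fun i => extpow k (A i))) ->
  hypersurface_sub
    (hyperplane (fun i => if i == ord0 then \det (A ord0) / a ord0 else a i))
    (det_poly (fun i =>
       if i == ord0 then dual_extpow k (A ord0) else extpow k (A i))) ->
  induces_representation A Q k.
Proof.
move=> szQ alpha0 a_alpha a0 Qax Q'ax detA hA uA mup_a sub1 sub2.
pose U := spectralmx (A ord0); pose d i := spectral_diag (A ord0) 0 i.
have unitaryU : U *m (map_mx Num.conj U)^T = 1%:M.
  by rewrite map_trmx; apply/unitarymxP/spectral_unitarymx.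
have uU : U \in unitmx := spectral_unit _.
have UA : U *m A ord0 = diag_mx (\row_i d i) *m U.
  have /orthomx_spectralP := hermitian_normalmx (hA ord0).
  rewrite -/U => {1}->; rewrite !mulmxA mulmxV // mul1mx; congr (diag_mx _ *m _).
  by apply/rowP => i; rewrite mxE.
have d0 j : d j != 0.
  have : \det (diag_mx (\row_i d i)) != 0.
    have : \det (U *m A ord0) != 0.
      by rewrite -unitfE -unitmxE unitmx_mul uU.
    by rewrite UA det_mulmx mulf_eq0 negb_or => /andP[].
  by rewrite det_diag => /prodf_neq0/(_ j isT); rewrite mxE.
have := on_axis_det_poly_diag uU UA d0.
have -> : on_axis ord0 (det_poly A) = on_axis ord0 Q * on_axis ord0 Q'.
  by rewrite detA; exact: rmorphM.
move=> /eqp_dvdr dvdE.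
(* On the axis Q divides a polynomial with roots 1/d_i, so the alpha_j are, with multiplicities, the
   eigenvalues of [A ord0] chosen by an increasing tuple p. *)
have [p pE] : exists p : 'I_(ext_dim N k), \prod_j ('X - ((alpha j)^-1)%:P) =
    \prod_j ('X - ((d (tnth (basis_tuple p) j))^-1)%:P).
  apply: (@basis_tuple_of_dvdp _ _ _ (fun i => (d i)^-1)).
  by rewrite -dvdE -(eqp_dvdl _ Qax) dvdp_mulr.
have kN : (k <= N)%N.
  have := uniq_leq_size (basis_tuple_uniq p) (s2 := enum 'I_N).
  rewrite size_tuple size_enum_ord; apply.
  by move=> x _; rewrite mem_enum.
have mu_p : \prod_j d (tnth (basis_tuple p) j) = a ord0.
  have := congr1 (fun f : {poly C} => f`_0) pE.
  rewrite -(big_map (fun j => (alpha j)^-1) predT (fun z => 'X - z%:P)).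
  rewrite -(big_map (fun j => (d (tnth (basis_tuple p) j))^-1) predT (fun z => 'X - z%:P)).
  rewrite !coef0_prod_XsubC !size_map !big_map => /mulfI H.
  by rewrite a_alpha; apply: invr_inj; rewrite -!prodfV H // signr_eq0.
pose V := rowsub (tnth (basis_tuple p)) U.
have fV : row_free V.
  apply/row_freeP; exists (colsub (tnth (basis_tuple p)) (invmx U)).
  rewrite /V -[LHS]/(mulmx _ _); apply/matrixP => s t.
  have /matrixP/(_ (tnth (basis_tuple p) s) (tnth (basis_tuple p) t)) := mulmxV uU.
  rewrite !mxE (inj_eq (elimT (tuple_uniqP _) (basis_tuple_uniq p))) => <-.
  by apply: eq_bigr => r _; rewrite !mxE.
(* The wedge of V A_i is a_i times that of V with a_i nonzero, so V A_i stays in the row space of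
   V. *)
have stV i : stablemx V (A i).
  apply: (wedge_colinear_sub (a0 i) fV); rewrite wedge_mulmx.
  exact: (wedge_common_eigenvector kN hA uA unitaryU UA mu_p mup_a sub1 sub2).
exists <<V>>%MS; split; first by rewrite genmxE (eqP fV).
  by move=> i; rewrite (eqmxMr _ (genmxE V)) genmxE.
have : \rank <<V>>%MS = k by rewrite genmxE (eqP fV).
have eqW : (row_base <<V>> :=: V)%MS by apply: eqmx_trans (eq_row_base _) (genmxE V).
move: (row_base <<V>>%MS) (row_base_free <<V>>%MS) eqW => W fW eqW rW.
rewrite rW in W fW eqW *.
have stW i : stablemx W (A i) by rewrite eqW (eqmxMr _ eqW).
have ZW i : conjmx W (A i) *m W = W *m A i by apply: conjmx_mulmx.
have [g detAg] := det_poly_stable fW ZW.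
have [T WT] : exists T, W = T *m V by apply/submxP; rewrite eqW.
have uT : T \in unitmx.
  by rewrite -row_free_unit /row_free -(mxrankMfree _ fV) -WT.
apply: (@associated_of_axis _ _ k _ g _ Q') => //.
- exact: msize_det_poly.
- by rewrite (eqp_size Qax) size_prod_XsubC -[index_enum _]enumT size_enum_ord.
- apply: eqp_trans (_ : _ %= _) _; last by rewrite eqp_sym; exact: Qax.
  (* V consists of eigenvectors of [A ord0], so the change of basis from W to V diagonalizes the
     restriction. *)
  rewrite pE; apply: (@on_axis_det_poly_diag _ _ _ _ (invmx T)).
  + by rewrite unitmx_inv.
  + apply: (row_free_inj fW); rewrite -[LHS]mulmxA ZW -[RHS]mulmxA WT mulKmx // mulmxA mulKmx //.
    rewrite /V mul_rowsub_mx UA; apply/matrixP => s t.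
    by rewrite [LHS]mxE !mul_diag_mx !mxE.
  + by [].
- move=> x; rewrite (eqp_root Qax) -(big_map (fun j => (alpha j)^-1) predT (fun z => 'X - z%:P)).
  rewrite root_prod_XsubC => /mapP[j _ ->].
  by rewrite horner_on_axis.
- by rewrite -detAg.
Qed.

(** * Assembling the two directions *)

(** It gathers the units hidden in three equalities of hypersurfaces into an explicit cofactor of Q
    in the determinant. *)
Lemma associated_quotient (D : comUnitRingType) (u1 u2 u3 d x y p q : D) :
  u1 \is a GRing.unit -> u3 \is a GRing.unit ->
  p = u1 * d -> p = u2 * (x * y) -> q = u3 * x ->
  d = q * (u1^-1 * u2 * u3^-1 * y).
Proof.
move=> uu1 uu3 p_d p_xy ->; apply: (mulrI uu1); rewrite -p_d p_xy.
transitivity ((u1 / u1) * (u3 / u3) * (u2 * (x * y))); last by ring.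
by rewrite !divrr // !mul1r.
Qed.

Theorem theoremC (R : realType) (n N k m : nat)
  (P Q : {mpoly R[i][n.+1]})
  (G : 'I_m -> {mpoly R[i][n.+1]}) (r : 'I_m -> nat) (S : {set 'I_m})
  (alpha : 'I_n.+1 -> 'I_k -> R[i]) (A : 'I_n.+1 -> 'M[R[i]]_N) :
  let a (i : 'I_n.+1) : R[i] := \prod_(j < k) alpha i j in
  P \is a mpolyOver n.+1 Num.real ->
  msize P = N.+1 ->
  components P G r ->
  (1 < m)%N ->
  S != set0 ->
  same_hypersurface Q (\prod_(l in S) G l ^+ r l) ->
  msize Q = k.+1 ->
  (forall (i : 'I_n.+1) (j : 'I_k), alpha i j != 0) ->
  (forall i : 'I_n.+1,
     on_axis i Q %= \prod_(j < k) ('X - ((alpha i j)^-1)%:P)) ->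
  (forall (j : 'I_k) (l : 'I_m),
     on_hypersurface (G l ^+ r l) (axis_point ord0 (alpha ord0 j)^-1) ->
     l \in S) ->
  (forall i : 'I_n.+1, A i \is hermsymmx) ->
  A ord0 \in unitmx ->
  determinantal_representation P A ->
  mup (a ord0) (char_poly (extpow k (A ord0))) = 1%N ->
  induces_representation A Q k <->
  hypersurface_sub (hyperplane a) (det_poly (fun i => extpow k (A i))) /\
  hypersurface_sub
    (hyperplane (fun i => if i == ord0 then \det (A ord0) / a ord0 else a i))
    (det_poly (fun i =>
       if i == ord0 then dual_extpow k (A ord0) else extpow k (A i))).
Proof.
move=> a _ _ [_ _ _ [u2 uu2 PG]] _ _ [u3 uu3 QG] szQ alpha0 Qax GS hA uA
  [u1 uu1 PA] mup_a.
split=> [rep|[sub1 sub2]].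
  have [v v0 [vE vD]] := hyperplanes_of_representation alpha0 Qax (hA ord0) uA rep.
  split; apply: (hyperplane_sub_det_poly v0) => i //.
  by case: eqP => [_|_].
pose Gc := \prod_(l in ~: S) G l ^+ r l.
have unit_eval (u : {mpoly R[i][n.+1]}) x : u \is a GRing.unit -> u.@[x] != 0.
  by move=> uu; rewrite -unitfE; exact: (rmorph_unit (meval x)).
have a0 i : a i != 0 by apply/prodf_neq0.
(* By [GS], no component outside S passes through a point 1/alpha_0j, and units vanish nowhere. *)
have evQ' j : (u1^-1 * u2 * u3^-1 * Gc).@[axis_point ord0 (alpha ord0 j)^-1] != 0.
  rewrite mevalM mulf_neq0 //.
    by apply: unit_eval; rewrite !unitrM !unitrV uu1 uu2 uu3.
  rewrite rmorph_prod; apply/prodf_neq0 => l; rewrite inE => lS.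
  by apply: contraNneq lS => /GS.
have detA : det_poly A = Q * (u1^-1 * u2 * u3^-1 * Gc).
  apply: (associated_quotient uu1 uu3 PA _ QG); rewrite PG; congr (_ * _).
  rewrite (bigID (fun l => l \in S)) /=; congr (_ * _).
  by apply: eq_bigl => l; rewrite inE.
have szQ' : (msize Q <= k.+1)%N by rewrite szQ.
exact: (representation_of_hyperplanes szQ' (alpha0 ord0) erefl a0 (Qax ord0) evQ' detA
  hA uA mup_a sub1 sub2).
Qed.
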